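(* Let $u(t,x)$ be a solution to the Cauchy problem $$u_t+\sum_{i=1}^n a_i(t,u)\,u_{x_i}=0,\qquad u(0,x)=u_0(x),\qquad t\in\mathbb{R}_+,\ x\in\mathbb{R}^n,$$ where $a_i$, $i=1,\dots,n$, are real-valued $C^1$ functions defined on some open subset of $\mathbb{R}_+\times\mathbb{R}$ and $u_0\in C^1_b(\mathbb{R}^n)$. Let $\Lambda$ be the set of all $t\in\mathbb{R}_+$ such that $$\inf_{y\in\mathbb{R}^n}\int_0^t\sum_{i=1}^n \frac{\partial a_i}{\partial u}(\tau,u_0(y))\,\frac{\partial u_0}{\partial y_i}(y)\,d\tau>-1,$$ put $t_*(u_0)=\sup\Lambda$, and assume $t_*(u_0)>0$. Then for $t\in[0,t_*(u_0))$ $$u(t,x)=\bar u(t,x)=\lim_{\sigma\to 0}u_\sigma(t,x),$$ where $u_\sigma(t,x)=\dfrac{\int_{\mathbb{R}}u\,P(t,x,du)}{\int_{\mathbb{R}}P(t,x,du)}$, with $P$ the measure-valued density (depending on $\sigma>0$) described in the context, and the limit exists pointwise.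
   Context: $\mathbb{R}_+=[0,\infty)$, and $C^1_b(\mathbb{R}^n)$ denotes real-valued bounded $C^1$ functions with bounded first derivatives. The functions $a_i$ are assumed to grow at infinity not quicker than a linear function in $u$. Write $a=(a_1,\dots,a_n)$. Let $\rho_0\in C(\mathbb{R}^n)$ be a bounded nonnegative function. For $\sigma>0$, $P(t,x,du)$ is the density with respect to Lebesgue measure $dx$ of the joint distribution $P(t,dx,du)=P(t,x,du)\,dx$ of $(X(t),U(t))$, where $dX_i=a_i(t,U)\,dt+\sigma\,dW_i$, $i=1,\dots,n$ ($W_1,\dots,W_n$ independent one-dimensional standard Brownian motions), $dU=0$, with initial data $P_0(dx,du)=\delta_{u_0(x)}(du)\,\rho_0(x)\,dx$, $\delta_{u_0(x)}$ being the Dirac measure at $u_0(x)$. It is a positive measure in $u$ and a function of $x$, solves the Fokker-Planck equation $\partial_tP=-\sum_k\partial_{x_k}(a_k(t,u)P)+\frac{\sigma^2}{2}\sum_k\partial_{x_k}^2P$ with these initial data, and is given by $$\int_{\mathbb{R}}\phi(u)\,P(t,x,du)=\frac{1}{(\sqrt{2\pi t}\,\sigma)^n}\int_{\mathbb{R}^n}\phi(u_0(y))\,\rho_0(y)\exp\Big(-\frac{\sum_{i=1}^n|\int_0^ta_i(\tau,u_0(y))\,d\tau+y_i-x_i|^2}{2\sigma^2t}\Big)dy$$ for all $\phi\in C_0(\mathbb{R})$ (at $t=0$ it is the initial data). The integral in the numerator of $u_\sigma$ is assumed to exist in the Lebesgue sense. The function $\bar u$ denotes the limit of $u_\sigma$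 as $\sigma\to0$.
   Formalization: The quotient u_σ is assumed well defined (nonzero denominator) for all σ>0, x and t∈[0,t_* ), t=0 included, which forces ρ_0>0 everywhere; for merely nonnegative ρ_0 the claim fails (a=0, ρ_0 supported in [1,2], x=0). *)

(* Defs.v *)
From HB Require Import structures.
From mathcomp Require Import all_boot all_order all_algebra.
From mathcomp Require Import all_classical all_reals all_analysis.

Set Implicit Arguments.
Unset Strict Implicit.
Unset Printing Implicit Defensive.

Import Order.TTheory GRing.Theory Num.Theory.
Import numFieldNormedType.Exports.

Local Open Scope classical_set_scope.
Local Open Scope ring_scope.

(* Lebesgue measure on R^n, as the n-fold product of the one-dimensional one.
   The library equips n.-tuple, but not 'rV_n, with the product sigma-algebra;
   lebesgue_box below pins the measure down. *)
Section LebesgueTuple.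
Context (R : realType).

Definition tuple_cons (n : nat)
    (p : measurableTypeR R * n.-tuple (measurableTypeR R)) :
    n.+1.-tuple (measurableTypeR R) :=
  [the n.+1.-tuple (measurableTypeR R) of p.1 :: p.2].

Lemma measurable_tuple_cons n : measurable_fun setT (@tuple_cons n).
Proof. by apply: measurable_cons; [exact: measurable_fst|exact: measurable_snd]. Qed.

Section Step.
Variables (n : nat)
  (m : {sigma_finite_measure set (n.-tuple (measurableTypeR R)) -> \bar R}).

Definition lebesgue_step : set (n.+1.-tuple (measurableTypeR R)) -> \bar R :=
  pushforward (@lebesgue_measure R \x m)%E (@tuple_cons n).

Let lebesgue_step0 : lebesgue_step set0 = 0%E.
Proof. by rewrite /lebesgue_step /pushforward preimage_set0 measure0. Qed.

Let lebesgue_step_ge0 A : (0 <= lebesgue_step A)%E.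
Proof. by rewrite /lebesgue_step /pushforward; apply: measure_ge0. Qed.

Let lebesgue_step_sigma_additive : semi_sigma_additive lebesgue_step.
Proof.
move=> F mF tF mUF; rewrite /lebesgue_step /pushforward preimage_bigcup.
apply: measure_semi_sigma_additive.
- by move=> k; rewrite -[X in measurable X]setTI; exact: measurable_tuple_cons.
- apply/trivIsetP => /= i j _ _ ij; rewrite -preimage_setI.
  by move/trivIsetP : tF => /(_ _ _ _ _ ij) ->//; rewrite preimage_set0.
- rewrite -preimage_bigcup -[X in measurable X]setTI.
  exact: measurable_tuple_cons.
Qed.

HB.instance Definition _ := isMeasure.Build _ _ _ lebesgue_step
  lebesgue_step0 lebesgue_step_ge0 lebesgue_step_sigma_additive.

Lemma lebesgue_step_sigma_finite : sigma_finite setT lebesgue_step.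
Proof.
have /sigma_finiteP[F [TF ndF Foo]] := sigma_finiteT (@lebesgue_measure R).
have /sigma_finiteP[G [TG ndG Goo]] := sigma_finiteT m.
pose g (x : n.+1.-tuple (measurableTypeR R)) :
  measurableTypeR R * n.-tuple (measurableTypeR R) :=
  (thead x, [tuple of behead x]).
have Kg p : g (tuple_cons p) = p.
  by case: p => a b; congr pair; apply: val_inj.
have mg : measurable_fun setT g.
  by apply: measurable_fun_pair; [exact: measurable_tnth|exact: measurable_behead].
exists (fun k => g @^-1` (F k `*` G k)).
  apply/esym; rewrite -subTset => x _.
  have [i _ Fi] : (\bigcup_i F i) (thead x) by rewrite -TF.
  have [j _ Gj] : (\bigcup_i G i) [tuple of behead x] by rewrite -TG.
  exists (maxn i j) => //; split => /=.
  - by move: Fi; apply/subsetPset/ndF/leq_maxl.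
  - by move: Gj; apply/subsetPset/ndG/leq_maxr.
move=> k; have [? ?] := Foo k; have [? ?] := Goo k; split.
  by rewrite -[_ @^-1` _]setTI; apply: mg => //; exact: measurableX.
rewrite /lebesgue_step /pushforward.
rewrite (_ : _ @^-1` _ = F k `*` G k); last first.
  by apply/seteqP; split => p; rewrite /preimage /mkset Kg.
by rewrite product_measure1E// lte_mul_pinfty// ge0_fin_numE.
Qed.

HB.instance Definition _ := Measure_isSigmaFinite.Build _ _ _
  lebesgue_step lebesgue_step_sigma_finite.

Definition lebesgue_step_sfm :
  {sigma_finite_measure set (n.+1.-tuple (measurableTypeR R)) -> \bar R} :=
  lebesgue_step.

End Step.

Fixpoint lebesgue_tuple (n : nat) :
    {sigma_finite_measure set (n.-tuple (measurableTypeR R)) -> \bar R} :=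
  if n is k.+1 then lebesgue_step_sfm (lebesgue_tuple k)
  else dirac ([tuple] : 0.-tuple (measurableTypeR R)).

Lemma lebesgue_box (n : nat) (A : 'I_n -> set (measurableTypeR R)) :
  (forall i, measurable (A i)) ->
  lebesgue_tuple n [set x | forall i, A i (tnth x i)] =
  (\prod_(i < n) lebesgue_measure (A i))%E.
Proof.
elim: n A => [|n IH] A mA.
  rewrite big_ord0 /= diracE mem_set//=.
  by case.
have mtail m (B : 'I_m -> set (measurableTypeR R)) : (forall i, measurable (B i)) ->
    measurable [set x : m.-tuple (measurableTypeR R) | forall i, B i (tnth x i)].
  move=> mB.
  rewrite (_ : [set _ | _] = \bigcap_(i in [set: 'I_m]) ((@tnth m _)^~ i @^-1` B i)); last first.
    by apply/seteqP; split => x /= h i; [move=> _; exact: h|exact: h].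
  apply: fin_bigcap_measurable => // i _.
  by rewrite -[X in measurable X]setTI; apply: (measurable_tnth i) => //; exact: mB.
rewrite big_ord_recl /= /lebesgue_step /pushforward.
rewrite (_ : _ @^-1` _ = A ord0 `*`
    [set x : n.-tuple (measurableTypeR R) | forall i, A (lift ord0 i) (tnth x i)]).
  rewrite product_measure1E//; last first.
    by apply: (mtail n (fun i => A (lift ord0 i))) => i; exact: mA.
  by rewrite (IH (fun i => A (lift ord0 i))).
apply/seteqP; split => -[a x] /=.
  move=> h; split; first exact: (h ord0).
  by move=> i; have := h (lift ord0 i); rewrite tnthS.
move=> [h0 h] i; case: (unliftP ord0 i) => [j ->|->]//.
by rewrite tnthS; exact: h.
Qed.

End LebesgueTuple.

(* C^1 regularity on a relatively open subset S of [0, +oo) x E. *)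
Section C1.
Context (R : realType) (E : normedModType R).

(* The quotient is restricted to s >= 0, so that the time derivative is
   two-sided for t > 0 and one-sided at t = 0. *)
Definition time_quotient (f : R -> E -> R) (t : R) (x : E) : set_system R :=
  (fun s => (f s x - f t x) / (s - t)) @ within `[0, +oo[ t^'.

Definition dtime (f : R -> E -> R) (t : R) (x : E) : R :=
  lim (time_quotient f t x).

Definition C1_on (I : Type) (e : I -> E) (S : set (R * E)) (f : R -> E -> R) :=
  [/\ {within S, continuous (fun p => f p.1 p.2)},
      (forall p, S p -> cvg (time_quotient f p.1 p.2)),
      {within S, continuous (fun p => dtime f p.1 p.2)},
      (forall i p, S p -> derivable (f p.1) p.2 (e i)) &
      (forall i, {within S, continuous (fun p => 'D_(e i) (f p.1) p.2)})].

Definition rel_open (S : set (R * E)) :=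
  exists2 O : set (R * E), open O & S = O `&` [set p | 0 <= p.1].

End C1.

Section Problem.
Context (R : realType) (n : nat).

Definition e_ (i : 'I_n) : 'rV[R]_n := delta_mx 0 i.

Definition C1b (u0 : 'rV[R]_n -> R) :=
  [/\ bounded_fun u0, continuous u0,
      (forall i x, derivable u0 x (e_ i)),
      (forall i, continuous ('D_(e_ i) u0)) &
      (forall i, bounded_fun ('D_(e_ i) u0))].

Definition C1_coef (D : set (R * R)) (a : 'I_n -> R -> R -> R) :=
  forall i, C1_on (fun _ : unit => 1 : R) D (a i).

(* |a(t, v)| <= C (1 + |v|) on D, with C uniform on bounded time intervals. *)
Definition linear_growth (D : set (R * R)) (a : 'I_n -> R -> R -> R) :=
  forall t1 : R, exists C : R, forall i t v,
    D (t, v) -> t <= t1 -> `|a i t v| <= C * (1 + `|v|).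

(* Classical solution on [0, T) x R^n. *)
Definition is_solution (D : set (R * R)) (a : 'I_n -> R -> R -> R)
    (u0 : 'rV[R]_n -> R) (T : \bar R) (u : R -> 'rV[R]_n -> R) :=
  [/\ C1_on e_ [set p | 0 <= p.1 /\ (p.1%:E < T)%E] u,
      (forall x, u 0 x = u0 x) &
      (forall (t : R) x, 0 <= t -> (t%:E < T)%E ->
        D (t, u t x) /\
        dtime u t x + \sum_(i < n) a i t (u t x) * 'D_(e_ i) (u t) x = 0)].

(* The a i are only meaningful on D, so membership of t in Lambda includes that
   the integrals over [0, t] are defined. *)
Definition Lambda (D : set (R * R)) (a : 'I_n -> R -> R -> R)
    (u0 : 'rV[R]_n -> R) : set R :=
  [set t | [/\ 0 <= t,
    (forall (tau : R) y, 0 <= tau <= t -> D (tau, u0 y)) &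
    ((-1)%:E < ereal_inf (range (fun y : 'rV[R]_n =>
      (\int[lebesgue_measure]_(tau in `[0, t])
         (\sum_(i < n) 'D_1 (a i tau) (u0 y) * 'D_(e_ i) u0 y))%:E)))%E]].

Definition tstar (D : set (R * R)) (a : 'I_n -> R -> R -> R)
    (u0 : 'rV[R]_n -> R) : \bar R :=
  ereal_sup [set t%:E | t in Lambda D a u0].

Definition displacement (a : 'I_n -> R -> R -> R) (u0 : 'rV[R]_n -> R)
    (t : R) (y : 'rV[R]_n) (i : 'I_n) : R :=
  \int[lebesgue_measure]_(tau in `[0, t]) a i tau (u0 y).

Definition integral_Rn (f : 'rV[R]_n -> R) : R :=
  \int[lebesgue_tuple R n]_y f (\row_i tnth y i).

Definition C0 (phi : R -> R) :=
  [/\ continuous phi, phi x @[x --> +oo] --> 0 & phi x @[x --> -oo] --> 0].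

(* P sigma t x is the measure P(t, x, du) on the Borel sets of R. *)
Definition density_family :=
  R -> R -> 'rV[R]_n -> {measure set (measurableTypeR R) -> \bar R}.

(* P sigma t x is the density at x of the joint law of (X(t), U(t)), where
   dX_i = a_i(t, U) dt + sigma dW_i and dU = 0, started from
   delta_(u0 x)(du) rho0(x) dx.  Since U is constant in time,
   X(t) = X(0) + int_0^t a(tau, U) dtau + sigma W(t), and integrating out the
   Gaussian W(t) gives the formula below, which determines P sigma t x. *)
Definition is_density (a : 'I_n -> R -> R -> R) (u0 rho0 : 'rV[R]_n -> R)
    (T : \bar R) (P : density_family) :=
  forall (sigma : R) x phi, 0 < sigma -> C0 phi ->
    (\int[P sigma 0%R x]_v (phi v)%:E)%E = (phi (u0 x) * rho0 x)%:E /\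
    forall t : R, 0 < t -> (t%:E < T)%E ->
      (\int[P sigma t x]_v (phi v)%:E)%E =
      ((Num.sqrt (2 * pi * t) * sigma) ^- n *
       integral_Rn (fun y => phi (u0 y) * rho0 y *
         expR (- (\sum_(i < n) `|displacement a u0 t y i + y 0 i - x 0 i| ^+ 2)
               / (2 * sigma ^+ 2 * t))))%:E.

Definition usigma (P : density_family) (sigma t : R) (x : 'rV[R]_n) : R :=
  (\int[P sigma t x]_v v) / (\int[P sigma t x]_v 1).

(* The quotient defining usigma makes sense on all of [0, T) x R^n. At t = 0 its
   denominator is rho0 x, so this forces rho0 to vanish nowhere. *)
Definition usigma_defined (T : \bar R) (P : density_family) :=
  forall (sigma t : R) x, 0 < sigma -> 0 <= t -> (t%:E < T)%E ->
    (P sigma t x).-integrable setT (fun v => v%:E) /\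
    \int[P sigma t x]_v 1 != 0.

Definition ubar (P : density_family) (t : R) (x : 'rV[R]_n) : R :=
  lim (usigma P sigma t x @[sigma --> 0^'+]).

End Problem.

(* Main.v *)
Require Import Defs.
From HB Require Import structures.
From mathcomp Require Import all_boot all_order all_algebra.
From mathcomp Require Import all_classical all_reals all_analysis.
From mathcomp Require Import measurable_realfun.
From mathcomp Require Import ring.
Import Order.TTheory GRing.Theory Num.Theory.
Import numFieldNormedType.Exports.
Local Open Scope classical_set_scope.
Local Open Scope ring_scope.

(** Fix t in the interval of existence and let
    Phi y = y + displacement a u0 t y be the position at time t of the
    characteristic issued from y.  Apart from a Gaussian prefactor, which
    cancels in the quotient, [usigma] is the average of u0 against the weight
    rho0 y * exp (- |Phi y - x|^2 / (2 sigma^2 t)), so the theorem is an instance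
    of Laplace's principle: as sigma tends to 0 the weight concentrates where
    Phi y is close to x.  Two facts about the solution u make this work.

    - u t (Phi y) = u0 y for every y ([solution_on_characteristics]).  Hence, if
      Phi y is close to x, then u0 y = u t (Phi y) is close to u t x, because
      u t is continuous.
    - Phi is onto ([characteristics_surjective]), so the set of those y for which
      Phi y is close to x contains a nonempty open set and has positive measure.

    Both come from a single statement,
    [solution_constant_along_characteristic]: if a curve c moves with velocity
    a(s, v) as long as (s, v) lies in the domain D of a, and u(s, c s) = v at one
    time, then this holds at all times.  Indeed w s = u(s, c s) - v has a closed
    zero set; at a zero the equation puts (s, v) in D, where a is locally
    Lipschitz in its second variable, so that |w'| <= L |w| nearby and w vanishes
    in a neighbourhood.  Followed forwards from (0, y) with v = u0 y the curve
    gives the first fact; followed backwards from (t, x) with v = u t x it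
    reaches time 0 at a preimage of x.  In the backward case it is not known in
    advance that (s, v) stays in D, which is why the velocity is cut off to 0
    outside D ([characteristic_curve]) and membership in D is a conclusion.

    The hypotheses of the Laplace estimate ([laplace_concentration]) are read off
    the denominator of [usigma]: it is nonzero for every sigma, so the weights
    are integrable, and its value at time 0 is rho0 x, so rho0 is positive
    everywhere.  Finally, the density formula is only
    given against functions vanishing at infinity; as u0 is bounded, it forces
    the measures P to live on a bounded interval, and the formula extends to all
    continuous functions ([Rintegral_of_C0_functional]), in particular to the
    constant 1 and the identity that define [usigma]. *)

Set Implicit Arguments.
Unset Strict Implicit.
Unset Printing Implicit Defensive.

(** * Mean value theorems and the chain rule *)

Lemma within_continuous_cvg (T U : topologicalType) (A : set T) (f : T -> U)
    (x : T) :
  {within A, continuous f} -> A x -> f @ within A (nbhs x) --> f x.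
Proof. by move=> /subspace_continuousP cf; exact: cf. Qed.

Lemma within_continuous_cvg_comp (T U : topologicalType) (I : Type) (A : set T)
    (f : T -> U) (F : set_system I) (FF : Filter F) (g : I -> T) (x : T) :
  {within A, continuous f} -> A x -> g @ F --> x -> (\forall z \near F, A (g z)) ->
  f (g z) @[z --> F] --> f x.
Proof.
move=> cf Ax gx FA.
apply: (cvg_comp g f _ (within_continuous_cvg cf Ax)) => B AB.
by near=> z; apply: (near (gx _ AB) z) => //; near: z.
Unshelve. all: by end_near. Qed.

Lemma cvg_rV (R : realType) (n : nat) (I : Type) (F : set_system I)
    (FF : Filter F) (g : I -> 'rV[R]_n) (l : 'rV[R]_n) :
  (forall i, g z 0 i @[z --> F] --> l 0 i) -> g @ F --> l.
Proof.
move=> gl; apply/cvg_ballP => e e0.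
have : \forall z \near F, forall i : 'I_n, ball (l 0 i) e (g z 0 i).
  by apply: filter_forall => i; apply: (gl i); exact: nbhsx_ballx.
by apply: filterS => z h; split => // i j; rewrite (ord1 i); exact: h.
Qed.

Lemma is_derive_cvg (R : realType) (f : R -> R) (s l : R) :
  h^-1 * (f (s + h) - f s) @[h --> 0^'] --> l -> is_derive s 1 f l.
Proof.
move=> fl.
have fl' : h^-1 *: (f (h *: 1 + s) - f s) @[h --> 0^'] --> l.
  apply: cvg_trans fl; apply: near_eq_cvg; apply: nearW => h /=.
  by rewrite [h *: 1]mulr1 [h + s]addrC.
by apply: DeriveDef; [apply/cvg_ex; exists l|exact: cvg_lim fl'].
Qed.

Lemma is_derive_line (R : realType) (V : normedModType R) (F : V -> R) z v s :
  derivable F (z + s *: v) v ->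
  is_derive s 1 (fun s => F (z + s *: v)) ('D_v F (z + s *: v)).
Proof.
move=> dF; apply: is_derive_cvg.
apply: cvg_trans (dF : _ --> 'D_v F _); apply: near_eq_cvg; apply: nearW => h /=.
by rewrite scalerDl [h *: v + _]addrC addrA.
Qed.

Lemma MVT_between (R : realType) (g dg : R -> R) (h : R) :
  (forall s : R, `|s| <= `|h| -> is_derive s 1 g (dg s)) ->
  exists2 c, `|c| <= `|h| & g h - g 0 = h * dg c.
Proof.
move=> gdg.
have cg a b : `|a| <= `|h| -> `|b| <= `|h| -> {within `[a, b], continuous g}.
  move=> ah bh; apply: derivable_within_continuous => s.
  rewrite in_itv/= => /andP[as_ sb].
  have : `|s| <= `|h|.
    rewrite ler_norml (le_trans sb) ?andbT ?(le_trans (ler_norm b))//.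
    by rewrite (le_trans _ as_)// lerNl (le_trans _ ah)// ler_normr lexx orbT.
  by move=> /gdg[].
have dg' a b : `|a| <= `|h| -> `|b| <= `|h| ->
    forall s : R, s \in `]a, b[ -> is_derive s 1 g (dg s).
  move=> ah bh s; rewrite in_itv/= => /andP[/ltW as_ /ltW sb]; apply: gdg.
  rewrite ler_norml (le_trans sb) ?andbT ?(le_trans (ler_norm b))//.
  by rewrite (le_trans _ as_)// lerNl (le_trans _ ah)// ler_normr lexx orbT.
have h0 : `|0 : R| <= `|h| by rewrite normr0.
have [hp|/ltW hn] := leP 0 h.
  have [c] := MVT_segment hp (dg' _ _ h0 (lexx _)) (cg _ _ h0 (lexx _)).
  rewrite in_itv/= => /andP[c0 ch] ->; exists c; last by rewrite subr0 mulrC.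
  by rewrite !ger0_norm.
have [c] := MVT_segment hn (dg' _ _ (lexx _) h0) (cg _ _ (lexx _) h0).
rewrite in_itv/= => /andP[c0 ch] e; exists c.
  by rewrite !ler0_norm ?lerN2.
by rewrite -[LHS]opprB e sub0r mulrN opprK mulrC.
Qed.

Lemma MVT_line (R : realType) (V : normedModType R) (F : V -> R) z v h :
  (forall s : R, `|s| <= `|h| -> derivable F (z + s *: v) v) ->
  exists2 c, `|c| <= `|h| & F (z + h *: v) - F z = h * 'D_v F (z + c *: v).
Proof.
move=> dF.
have [s sh|c ch e] := @MVT_between R (fun s => F (z + s *: v))
  (fun s => 'D_v F (z + s *: v)) h; first exact/is_derive_line/dF.
by exists c => //; rewrite -e scale0r addr0.
Qed.

(** Changing the coordinates of x into those of x' one at a time, the mean value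
    theorem applies to each change; the intermediate points stay in the box
    spanned by x and x', hence tend to x together with x'. *)
Lemma telescope_partials (R : realType) (n : nat) (F : 'rV[R]_n -> R)
    (x x' : 'rV[R]_n) :
  (forall i z, derivable F z (e_ R i)) ->
  exists2 xi : 'I_n -> 'rV[R]_n,
    forall i j, `|xi i 0 j - x 0 j| <= `|x' 0 j - x 0 j| &
    F x' - F x = \sum_(i < n) (x' 0 i - x 0 i) * 'D_(e_ R i) F (xi i).
Proof.
move=> dF.
pose z k := \row_(j < n) (if (j < k)%N then x' 0 j else x 0 j).
have zS (i : 'I_n) : z i.+1 = z i + (x' 0 i - x 0 i) *: e_ R i.
  apply/rowP => j; rewrite !mxE eqxx/= ltnS leq_eqVlt.
  have [/val_inj ->|ji] := eqVneq (j : nat) i.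
    by rewrite !eqxx ltnn mulr1 subrKC.
  have /negbTE-> : j != i by apply: contra ji => /eqP ->.
  by rewrite mulr0 addr0.
have H (i : 'I_n) : exists xi : 'rV[R]_n,
    (forall j, `|xi 0 j - x 0 j| <= `|x' 0 j - x 0 j|) /\
    F (z i.+1) - F (z i) = (x' 0 i - x 0 i) * 'D_(e_ R i) F xi.
  have [c ch e] := @MVT_line _ _ F (z i) (e_ R i) (x' 0 i - x 0 i) (fun _ _ => dF _ _).
  exists (z i + c *: e_ R i); split; last by rewrite zS.
  move=> j; rewrite !mxE eqxx/=.
  have [->|ji] := eqVneq j i; first by rewrite ltnn mulr1 addrAC subrr add0r.
  by rewrite mulr0 addr0; case: ifP => // _; rewrite subrr normr0.
have [xi xiP] := choice H; exists xi; first by move=> i; exact: (xiP i).1.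
rewrite -(eq_bigr _ (fun i _ => (xiP i).2)).
rewrite -(big_mkord xpredT (fun i => F (z i.+1) - F (z i))) telescope_sumr//.
by congr (F _ - F _); apply/rowP => j; rewrite !mxE ?ltn_ord// ltn0.
Qed.

(** At a positive time the restriction of the quotient to nonnegative times is
    invisible, so that [dtime] is an ordinary derivative. *)
Lemma dtime_is_derive (R : realType) (E : normedModType R) (f : R -> E -> R)
    (t : R) (x : E) :
  0 < t -> cvg (time_quotient f t x) -> is_derive t 1 (f ^~ x) (dtime f t x).
Proof.
move=> t0 cf; apply: is_derive_cvg.
have sh : (t + h) @[h --> 0^'] --> within `[0, +oo[ t^'.
  move=> B; rewrite /within /= => tB; rewrite nbhs_filterE/=.
  near=> h.
  have h0 : h != 0 by near: h; exact: nbhs_dnbhs_neq.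
  have hB : (t + h) != t -> 0 <= t + h -> B (t + h).
    near: h.
    have [e /= e0 eB] := tB.
    exists e => //= h /= he _ th th0; apply: eB => //=; last by rewrite in_itv/= th0.
    by rewrite opprD addrA subrr.
  apply: hB; first by rewrite -subr_eq0 addrAC subrr add0r.
  rewrite -lerBlDl sub0r; suff : `|h| < t by move=> /ltr_normlP[+ _]; rewrite ltrNl => /ltW.
  by near: h; exact: dnbhs0_lt.
have := cvg_comp _ _ sh (cf : _ --> dtime f t x).
apply: cvg_trans; apply: near_eq_cvg; apply: nearW => h /=.
by rewrite mulrC addrAC subrr add0r.
Unshelve. all: by end_near. Qed.

Definition strip (R : realType) (n : nat) (T : \bar R) : set (R * 'rV[R]_n) :=
  [set p | 0 <= p.1 /\ (p.1%:E < T)%E].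

Lemma strip_interior (R : realType) (T : \bar R) (s : R) :
  0 < s -> (s%:E < T)%E ->
  exists2 d, 0 < d & forall r, `|r - s| < d -> 0 < r /\ (r%:E < T)%E.
Proof.
move=> s0 sT.
have [d d0 dT] : exists2 d, 0 < d & forall r, r < s + d -> (r%:E < T)%E.
  case: T sT => [T||]//=; last first.
    by move=> _; exists 1 => // r _; exact: ltry.
  rewrite lte_fin => sT; exists (T - s); first by rewrite subr_gt0.
  by move=> r; rewrite lte_fin subrKC.
exists (Num.min d s); first by rewrite lt_min d0.
move=> r; rewrite lt_min => /andP[/ltr_distlDr rd /ltr_distlCBl rs]; split.
  by rewrite subrr in rs.
exact: dT.
Qed.

(** Continuity of the partial derivatives makes up for differentiability in the
    sense of Frechet: the increment of u along the path is split into a time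
    increment and coordinate increments, each given by a mean value theorem at
    points that converge to (s, c s). *)
Lemma chain_rule_along_path (R : realType) (n : nat) (T : \bar R)
    (u : R -> 'rV[R]_n -> R) (c : R -> 'rV[R]_n) (dc : 'I_n -> R) (s : R) :
  C1_on (@e_ R n) (strip T) u -> 0 < s -> (s%:E < T)%E ->
  (forall i, is_derive s 1 (fun r => c r 0 i) (dc i)) ->
  is_derive s 1 (fun r => u r (c r))
    (dtime u s (c s) + \sum_(i < n) dc i * 'D_(e_ R i) (u s) (c s)).
Proof.
move=> [cu tu ctu du cdu] s0 sT dcs; apply: is_derive_cvg.
have [d d0 ds] := strip_interior s0 sT.
have Ss (x : 'rV[R]_n) : strip T (s, x) by split => //=; exact: ltW.
have incr h : exists p : R * ('I_n -> 'rV[R]_n), `|h| < d ->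
  [/\ `|p.1| <= `|h|,
      forall i j, `|p.2 i 0 j - c s 0 j| <= `|c (s + h) 0 j - c s 0 j| &
      u (s + h) (c (s + h)) - u s (c s) = h * dtime u (s + p.1) (c (s + h)) +
        \sum_(i < n) (c (s + h) 0 i - c s 0 i) * 'D_(e_ R i) (u s) (p.2 i)].
  have [hd|] := boolP (`|h| < d); last by move=> _; exists (0, fun=> 0).
  have dt (r : R) : `|r| <= `|h| -> is_derive r 1 (fun r => u (s + r) (c (s + h)))
      (dtime u (s + r) (c (s + h))).
    move=> rh.
    have [r0 rT] : 0 < s + r /\ ((s + r)%:E < T)%E.
      by apply: ds; rewrite addrAC subrr add0r (le_lt_trans rh).
    have dut := dtime_is_derive r0 (tu (s + r, c (s + h)) (conj (ltW r0) rT)).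
    have dsr : is_derive r (1 : R) (fun r => s + r) (1 : R).
      rewrite (_ : (fun r => s + r) = shift s); first exact: is_derive_shift.
      by apply/funext => y; rewrite /= addrC.
    by have := @is_derive1_comp _ _ _ _ _ _ dut dsr; rewrite mulr1.
  have [th thh e1] := MVT_between dt.
  have [xi xic e2] := @telescope_partials R n (u s) (c s) (c (s + h))
    (fun i z => du i (s, z) (Ss z)).
  by exists (th, xi) => _; split => //=; rewrite -e1 -e2 addr0 addrA subrK.
(* p h holds the points at which the mean value theorems are applied *)
have [p pP] := choice incr.
have hd : \forall h \near (0 : R)^', `|h| < d by exact: dnbhs0_lt.
have hn0 : \forall h \near (0 : R)^', h != 0 by exact: nbhs_dnbhs_neq.
have h0 : h @[h --> (0 : R)^'] --> (0 : R) by exact: nbhs_dnbhs.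
have cq i : h^-1 * (c (s + h) 0 i - c s 0 i) @[h --> (0 : R)^'] --> dc i.
  have [dci <-] := dcs i.
  apply: cvg_trans (dci : _ --> 'D_1 _ s); apply: near_eq_cvg; apply: nearW => h /=.
  by rewrite [h *: 1]mulr1 [h + s]addrC.
have ccont i : c (s + h) 0 i @[h --> (0 : R)^'] --> c s 0 i.
  have : {for s, continuous (fun r => c r 0 i)}.
    by apply/differentiable_continuous/derivable1_diffP; have [] := dcs i.
  move=> ci; apply: (@continuous_cvg _ _ _ _ _ (fun h => s + h) (fun r => c r 0 i) s ci).
  by rewrite -[X in _ --> X](addr0 s); apply: cvgD => //; exact: cvg_cst.
have xic i : (p h).2 i @[h --> (0 : R)^'] --> c s.
  apply: cvg_rV => j; apply/cvgrPdist_le => e e0.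
  near=> h; have [|_ + _] := pP h; first by near: h.
  rewrite distrC => /(_ i j)/le_trans; apply; rewrite distrC.
  by near: h; move/cvgrPdist_le : (ccont j) => /(_ _ e0).
have thc : s + (p h).1 @[h --> (0 : R)^'] --> s.
  rewrite -[X in _ --> X]addr0; apply: cvgD; first exact: cvg_cst.
  apply/cvgrPdist_le => e e0.
  near=> h; have [|+ _ _] := pP h; first by near: h.
  by rewrite sub0r normrN => /le_trans; apply; near: h; exact: dnbhs0_le.
have limt : dtime u (s + (p h).1) (c (s + h)) @[h --> (0 : R)^'] --> dtime u s (c s).
  apply: (@within_continuous_cvg_comp _ _ _ _ (fun q => dtime u q.1 q.2) _ _
    (fun h => (s + (p h).1, c (s + h))) (s, c s) ctu (Ss _)).
    exact: (cvg_pair thc (cvg_rV _ ccont)).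
  near=> h; have hltd : `|h| < d by near: h.
  have [//|ph _ _] := pP h.
  have [/ltW] : 0 < s + (p h).1 /\ ((s + (p h).1)%:E < T)%E.
    by apply: ds; rewrite addrAC subrr add0r (le_lt_trans ph).
  by move=> ? ?; split.
have limx i : 'D_(e_ R i) (u s) ((p h).2 i) @[h --> (0 : R)^'] -->
    'D_(e_ R i) (u s) (c s).
  apply: (@within_continuous_cvg_comp _ _ _ _ (fun q => 'D_(e_ R i) (u q.1) q.2) _ _
    (fun h => (s, (p h).2 i)) (s, c s) (cdu i) (Ss _)).
    exact: (cvg_pair (cvg_cst _) (xic i)).
  by apply: nearW => h; exact: Ss.
have limS : \sum_(i < n) (h^-1 * (c (s + h) 0 i - c s 0 i) *
    'D_(e_ R i) (u s) ((p h).2 i)) @[h --> (0 : R)^'] -->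
    \sum_(i < n) dc i * 'D_(e_ R i) (u s) (c s).
  apply: cvg_big => [|i _]; last by apply: cvgM; [exact: cq|exact: limx].
  exact: (@add_continuous R).
have lim : dtime u (s + (p h).1) (c (s + h)) + \sum_(i < n)
      (h^-1 * (c (s + h) 0 i - c s 0 i) * 'D_(e_ R i) (u s) ((p h).2 i))
    @[h --> (0 : R)^'] -->
    dtime u s (c s) + \sum_(i < n) dc i * 'D_(e_ R i) (u s) (c s).
  exact: cvgD.
apply: cvg_trans lim; apply: near_eq_cvg; near=> h.
have [|_ _ ->] := pP h; first by near: h.
rewrite mulrDr mulKf ?mulr_sumr; last by near: h.
by congr (_ + _); apply: eq_bigr => i _; rewrite mulrA.
Unshelve. all: by end_near. Qed.


(** * Constancy of the solution along characteristics *)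

(** The zero set is closed by continuity and open by the local hypothesis. *)
Lemma connected_zero_set (R : realType) (T : topologicalType) (A : set T)
    (w : T -> R) (x0 : T) :
  connected A -> {within A, continuous w} ->
  (forall x, A x -> w x = 0 -> \forall y \near x, A y -> w y = 0) ->
  A x0 -> w x0 = 0 -> forall x, A x -> w x = 0.
Proof.
move=> cA cw loc Ax0 wx0.
pose B := A `&` [set x | w x = 0].
suff BA : B = A by move=> x; rewrite -[in A x]BA => -[].
apply: cA; first by exists x0.
- exists ([set x | A x -> w x = 0]°); first exact: open_interior.
  apply/seteqP; split=> x [Ax]; first by move=> wx; split => //; exact: loc.
  by move=> /interior_subset wx; split => //; exact: wx.
- exists (closure B); first exact: closed_closure.
  apply/seteqP; split=> x [Ax]; first by move=> wx; split => //; exact: subset_closure.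
  move=> clx; split => //=; apply/eqP/negP => /negP wx.
  have wx0' : \forall y \near within A (nbhs x), w y != 0.
    have /cvgrPdist_lt/(_ `|w x|) := within_continuous_cvg cw Ax.
    rewrite normr_gt0 => /(_ wx); apply: filterS => y.
    by apply: contraTneq => ->; rewrite subr0 ltxx.
  by have [y [[Ay /= wy]]] := clx _ wx0'; move=> /(_ Ay); rewrite wy eqxx.
Qed.

(** A substitute for Gronwall's lemma on a short interval: at a maximum m of |w|,
    the mean value theorem from the zero of w bounds |w m| by
    L (b - a) |w m|, and L (b - a) < 1. *)
Lemma derive_le_self_zero (R : realType) (w dw : R -> R) (a b L : R) :
  a <= b -> {within `[a, b], continuous w} ->
  (forall s, s \in `]a, b[ -> is_derive s 1 w (dw s) /\ `|dw s| <= L * `|w s|) ->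
  0 <= L -> L * (b - a) < 1 -> w a = 0 \/ w b = 0 ->
  forall s, s \in `[a, b] -> w s = 0.
Proof.
move=> ab cw wdw L0 Lab w0.
have cnw : {within `[a, b], continuous (fun s => `|w s|)}.
  by move=> s; apply: continuous_comp; [exact: cw|exact: norm_continuous].
have [m mab mmax] := EVT_max ab cnw.
have sub c d : a <= c -> d <= b -> {within `[c, d], continuous w} /\
    forall s, s \in `]c, d[ -> is_derive s 1 w (dw s).
  move=> ac db; split.
    apply: continuous_subspaceW cw; apply: subset_itv; rewrite bnd_simp//.
  move=> s scd; apply: (wdw s _).1; move: scd; rewrite !in_itv/= => /andP[cs sd].
  by rewrite (le_lt_trans ac)//= (lt_le_trans sd).
have [am mb] : a <= m /\ m <= b by move: mab; rewrite in_itv/= => /andP.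
suff : `|w m| <= (L * (b - a)) * `|w m|.
  rewrite -subr_le0 -{1}[`|w m|]mul1r -mulrBl => wm.
  have {}wm : `|w m| <= 0.
    by rewrite -(pmulr_rle0 _ (_ : 0 < 1 - L * (b - a)))// subr_gt0.
  move=> s sab; apply/eqP; rewrite -normr_le0; apply: le_trans wm.
  exact: mmax.
have key s (d : R) : s \in `]a, b[ -> 0 <= d <= b - a ->
    `|dw s * d| <= L * (b - a) * `|w m|.
  move=> sab /andP[d0 dab]; rewrite normrM (ger0_norm d0) mulrAC.
  apply: ler_pM => //; apply: (le_trans (wdw _ sab).2).
  by rewrite ler_wpM2l// mmax//; exact: subset_itv_oo_cc.
case: w0 => w0.
- move: am; rewrite le_eqVlt => /predU1P[<-|am].
    by rewrite w0 normr0 mulr0.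
  have [cw' dw'] := sub a m (lexx _) mb.
  have [s sam e] := MVT am dw' cw'.
  rewrite [X in `|X| <= _](_ : _ = dw s * (m - a)); last by rewrite -e w0 subr0.
  apply: key.
    by move: sam; rewrite !in_itv/= => /andP[-> /lt_le_trans ->].
  by rewrite subr_ge0 ltW//= lerD2r.
- move: mb; rewrite le_eqVlt => /predU1P[->|mb].
    by rewrite w0 normr0 mulr0.
  have [cw' dw'] := sub m b am (lexx _).
  have [s smb e] := MVT mb dw' cw'.
  rewrite [X in `|X| <= _](_ : _ = - (dw s * (b - m))); last by rewrite -e w0 sub0r opprK.
  rewrite normrN; apply: key.
    by move: smb; rewrite !in_itv/= => /andP[/(le_lt_trans am) ->].
  by rewrite subr_ge0 ltW//= lerD2l lerN2.
Qed.

Lemma C1_locally_lipschitz (R : realType) (D : set (R * R)) (f : R -> R -> R)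
    (s v : R) :
  rel_open D -> C1_on (fun _ : unit => 1 : R) D f -> D (s, v) ->
  exists K, \forall p \near (s, v), 0 <= p.1 ->
    D (p.1, v) /\ `|f p.1 p.2 - f p.1 v| <= K * `|p.2 - v|.
Proof.
move=> [U oU DU] [_ _ _ df cdf] Dsv.
exists (`|'D_1 (f s) v| + 1).
have nO : \forall p \near (s, v), 0 <= p.1 -> D p.
  have : nbhs (s, v) U by apply: open_nbhs_nbhs; split => //; move: Dsv; rewrite DU => -[].
  by apply: filterS => p Up p0; rewrite DU.
have nd : \forall p \near (s, v), D p -> `|'D_1 (f p.1) p.2| <= `|'D_1 (f s) v| + 1.
  have /cvgrPdist_le := within_continuous_cvg (cdf tt) Dsv.
  move=> /(_ 1 ltr01); rewrite near_withinE; apply: filterS => p pd Dp.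
  move: (pd Dp); rewrite distrC -lerBlDl; apply: le_trans; exact: lerB_dist.
have [e /= e0 eP] := (nbhs_ballP _ _).1 (filterI nO nd).
apply/nbhs_ballP; exists e => //= -[s' v'] [/= bs bv] s0.
have inD r : `|r| <= `|v' - v| -> D (s', v + r) /\
    `|'D_1 (f s') (v + r)| <= `|'D_1 (f s) v| + 1.
  move=> rv; have [] := eP (s', v + r).
    split => //=; rewrite /ball/= opprD addrA subrr add0r normrN (le_lt_trans rv)//.
    by move: bv; rewrite /ball/= distrC.
  by move=> /(_ s0) Dr /(_ Dr).
split; first by rewrite -[v]addr0; apply: (inD 0 _).1; rewrite normr0.
have [r rh|r rh] := @MVT_line R R (f s') v 1 (v' - v).
  by rewrite [_ *: _]mulr1; exact: (df tt (s', v + r) (inD _ rh).1).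
rewrite ![_ *: _]mulr1 subrKC => ->; rewrite normrM mulrC ler_wpM2r//.
exact: (inD _ rh).2.
Qed.

(** The velocity of c is prescribed only at times when (s, v) is in D, and nothing
    says in advance that this ever happens after or before s0; whenever
    u(s, c s) = v, though, the equation itself provides (s, v) in D.  The
    conclusion therefore propagates in both directions of time from s0. *)
Lemma solution_constant_along_characteristic (R : realType) (n : nat)
    (D : set (R * R)) (a : 'I_n -> R -> R -> R) (u0 : 'rV[R]_n -> R)
    (T : \bar R) (u : R -> 'rV[R]_n -> R) (t v : R) (c : R -> 'rV[R]_n) :
  rel_open D -> C1_coef D a -> is_solution D a u0 T u -> (t%:E < T)%E ->
  {within `[0, t], continuous c} ->
  (forall s, 0 < s < t -> D (s, v) ->
    forall i, is_derive s 1 (fun r => c r 0 i) (a i s v)) ->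
  forall s0, 0 <= s0 <= t -> u s0 (c s0) = v ->
  forall s, 0 <= s <= t -> u s (c s) = v.
Proof.
move=> oD Ca [C1u _ sol] tT cc dc s0 s0t us0 s st; apply/eqP; rewrite -subr_eq0; apply/eqP.
have [cu _ _ _ cdu] := C1u.
pose w r := u r (c r) - v.
have inS r : r \in `[0, t] -> strip T (r, c r).
  by rewrite in_itv/= => /andP[r0 rt]; split => //=; rewrite (le_lt_trans _ tT)// lee_fin.
have cpath r : r \in `[0, t] ->
    (q, c q) @[q --> within `[0, t] (nbhs r)] --> (r, c r).
  move=> rt; apply: (cvg_pair (G := nbhs r) (H := nbhs (c r))); last exact: within_continuous_cvg cc rt.
  exact: cvg_within.
have nearS r : r \in `[0, t] ->
    \forall q \near within `[0, t] (nbhs r), strip T (q, c q).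
  by move=> rt; rewrite near_withinE; apply: nearW => q; exact: inS.
have cuc r : r \in `[0, t] ->
    u q (c q) @[q --> within `[0, t] (nbhs r)] --> u r (c r).
  move=> rt.
  exact: (@within_continuous_cvg_comp _ _ _ _ (fun p => u p.1 p.2) _ _
    (fun q => (q, c q)) (r, c r) cu (inS _ rt) (cpath _ rt) (nearS _ rt)).
have cw : {within `[0, t], continuous w}.
  apply/subspace_continuousP => r rt; apply: cvgB; last exact: cvg_cst.
  exact: cuc.
apply: (connected_zero_set (@segment_connected _ 0 t) cw _ (x0 := s0)) => //=;
  rewrite ?in_itv//; last by rewrite /w us0 subrr.
(* at a zero s of w the equation holds at (s, c s), whose value is v *)
move=> {s st} s st ws.
have us : u s (c s) = v by apply/eqP; rewrite -subr_eq0; apply/eqP.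
have Dsv : D (s, v).
  rewrite -us; have [s_ge0 sT] := inS s st; exact: (sol s (c s) s_ge0 sT).1.
have [K KP] := choice (fun i => C1_locally_lipschitz oD (Ca i) Dsv).
have cuc2 : (q, u q (c q)) @[q --> within `[0, t] (nbhs s)] --> (s, v).
  apply: (cvg_pair (G := nbhs s) (H := nbhs v)); first exact: cvg_within.
  by rewrite -us; exact: cuc.
have lip : \forall q \near within `[0, t] (nbhs s), forall i, D (q, v) /\
    `|a i q (u q (c q)) - a i q v| <= K i * `|w q|.
  apply: filter_forall => i.
  have inI : \forall q \near within `[0, t] (nbhs s), q \in `[0, t].
    by rewrite near_withinE; exact: nearW.
  apply: filterS2 inI (cuc2 _ (KP i)) => q /= qt; apply.
  by move: qt; rewrite in_itv/= => /andP[].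
pose M i := `|'D_(e_ R i) (u s) (c s)| + 1.
have bnd : \forall q \near within `[0, t] (nbhs s), forall i,
    `|'D_(e_ R i) (u q) (c q)| <= M i.
  apply: filter_forall => i.
  have : 'D_(e_ R i) (u q) (c q) @[q --> within `[0, t] (nbhs s)] -->
      'D_(e_ R i) (u s) (c s).
    exact: (@within_continuous_cvg_comp _ _ _ _
      (fun p => 'D_(e_ R i) (u p.1) p.2) _ _ (fun q => (q, c q)) (s, c s)
      (cdu i) (inS _ st) (cpath _ st) (nearS _ st)).
  move=> /cvgrPdist_le/(_ 1 ltr01); apply: filterS => q.
  rewrite distrC -lerBlDl; apply: le_trans; exact: lerB_dist.
(* near s, the velocities are K i-Lipschitz in v and the space derivatives of
   u along c are at most M i, so L will satisfy |w'| <= L |w| there *)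
pose L := \sum_(i < n) `|K i| * M i.
have L0 : 0 <= L by apply: sumr_ge0 => i _; rewrite mulr_ge0// addr_ge0.
have : \forall q \near s, q \in `[0, t] ->
    (forall i, D (q, v) /\ `|a i q (u q (c q)) - a i q v| <= K i * `|w q|) /\
    (forall i, `|'D_(e_ R i) (u q) (c q)| <= M i).
  by move: lip bnd; rewrite !near_withinE; apply: filterS2 => q + + qt; split; auto.
move=> /nbhs_ballP[e /= e0 eP].
pose d := Num.min (e / 2) (L + 1)^-1.
have d0 : 0 < d by rewrite lt_min divr_gt0//= invr_gt0 ltr_wpDl.
have de : d < e by rewrite gt_min ltr_pdivrMr// ltr_pMr// ltr1n.
have Ld : L * d < 1.
  rewrite (@le_lt_trans _ _ (L * (L + 1)^-1))//.
    by rewrite ler_wpM2l// ge_min lexx orbT.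
  by rewrite ltr_pdivrMr ?ltr_wpDl// mul1r ltrDl.
have dw (x y r : R) : x \in `[0, t] -> y \in `[0, t] -> s - d <= x -> y <= s + d ->
    x < r < y ->
  is_derive r 1 w (dtime u r (c r) + \sum_(i < n) a i r v * 'D_(e_ R i) (u r) (c r))
  /\ `|dtime u r (c r) + \sum_(i < n) a i r v * 'D_(e_ R i) (u r) (c r)| <= L * `|w r|.
  rewrite !in_itv/= => /andP[x0 _] /andP[_ yt] sx ys /andP[xr ry].
  have r0 : 0 < r by exact: le_lt_trans xr.
  have rt : r < t by exact: lt_le_trans yt.
  have rI : r \in `[0, t] by rewrite in_itv/= !ltW.
  have [rlip rbnd] : (forall i, D (r, v) /\
      `|a i r (u r (c r)) - a i r v| <= K i * `|w r|) /\
      forall i, `|'D_(e_ R i) (u r) (c r)| <= M i.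
    apply: eP => //; rewrite /ball/= ltr_distlC.
    by rewrite (lt_trans _ (le_lt_trans sx xr)) ?ltrD2l ?ltrN2//=
      (lt_trans (lt_le_trans ry ys)) ?ltrD2l.
  have rT : (r%:E < T)%E by exact: (inS _ rI).2.
  have Drv i : is_derive r 1 (fun r => c r 0 i) (a i r v).
    by apply: dc; [rewrite r0|exact: (rlip i).1].
  split.
    have := chain_rule_along_path C1u r0 rT Drv => h.
    by rewrite -[X in is_derive _ _ _ X]subr0; apply: is_deriveB.
  (* subtracting the equation at (r, c r) leaves a difference of velocities *)
  have -> : dtime u r (c r) + \sum_(i < n) a i r v * 'D_(e_ R i) (u r) (c r) =
      - \sum_(i < n) (a i r (u r (c r)) - a i r v) * 'D_(e_ R i) (u r) (c r).
    have /eqP := (sol r (c r) (ltW r0) rT).2; rewrite addr_eq0 => /eqP ->.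
    rewrite addrC -sumrB -sumrN; apply: eq_bigr => i _.
    by rewrite mulrBl opprB.
  rewrite normrN (le_trans (ler_norm_sum _ _ _))// mulr_suml ler_sum// => i _.
  rewrite normrM mulrAC ler_pM// (le_trans (rlip i).2)//.
  by rewrite ler_wpM2r// ler_norm.
near=> r => /= rt.
have rd : `|s - r| < d by near: r; exact: nbhsx_ballx.
have sub x y : x \in `[0, t] -> y \in `[0, t] -> {within `[x, y], continuous w}.
  rewrite !in_itv/= => /andP[x0 _] /andP[_ yt].
  by apply: continuous_subspaceW cw; apply: subset_itv; rewrite bnd_simp.
have [rs1 rs2] : s - d <= r /\ r <= s + d.
  by move: rd; rewrite ltr_distlC => /andP[/ltW -> /ltW ->].
have [sr|/ltW rs] := leP s r.
- have sds : s - d <= s by rewrite gerBl ltW.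
  apply: (derive_le_self_zero sr (sub _ _ st rt) (dw := fun r => dtime u r (c r) +
    \sum_(i < n) a i r v * 'D_(e_ R i) (u r) (c r)) _ L0).
  + by move=> q; rewrite in_itv/=; exact: dw.
  + by rewrite (le_lt_trans _ Ld)// ler_wpM2l// lerBlDl.
  + by left.
  + by rewrite in_itv/= sr lexx.
- have sds : s <= s + d by rewrite lerDl ltW.
  apply: (derive_le_self_zero rs (sub _ _ rt st) (dw := fun r => dtime u r (c r) +
    \sum_(i < n) a i r v * 'D_(e_ R i) (u r) (c r)) _ L0).
  + by move=> q; rewrite in_itv/=; exact: dw.
  + by rewrite (le_lt_trans _ Ld)// ler_wpM2l// lerBlDl -lerBlDr.
  + by right.
  + by rewrite in_itv/= rs lexx.
Unshelve. all: by end_near. Qed.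

Lemma characteristic_speed_integrable (R : realType) (n : nat)
    (D : set (R * R)) (a : 'I_n -> R -> R -> R) (t v : R) (i : 'I_n) :
  rel_open D -> C1_coef D a -> linear_growth D a ->
  (@lebesgue_measure R).-integrable setT
    (EFin \o ((fun s => a i s v) \_ (`[0, t] `&` [set s | D (s, v)]))).
Proof.
move=> [U oU DU] Ca growth.
set S := _ `&` _.
have mS : measurable S.
  (* on [0, t], membership in D is membership in an open set of the plane *)
  have -> : S = `[0, t] `&` [set s | U (s, v)].
    rewrite /S DU; apply/seteqP; split=> s /= [st]; first by case.
    by move=> Us; split => //; split => //=; move: st; rewrite in_itv/= => /andP[].
  apply: measurableI => //; apply: open_measurable.
  apply: (@open_comp _ _ (fun s => (s, v))) => // s _.
  by apply: (cvg_pair (G := nbhs s) (H := nbhs v)); [exact: cvg_id|exact: cvg_cst].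
have cS : {within S, continuous (fun s => a i s v)}.
  apply/subspace_continuousP => s Ss.
  have [ca _ _ _ _] := Ca i.
  apply: (@within_continuous_cvg_comp _ _ _ _ (fun p => a i p.1 p.2) _ _
    (fun s => (s, v)) (s, v) ca Ss.2).
    by apply: (cvg_pair (G := nbhs s) (H := nbhs v)); [exact: cvg_within|exact: cvg_cst].
  by rewrite near_withinE; apply: nearW => q [].
have [C CP] := growth t.
suff : (@lebesgue_measure R).-integrable S (EFin \o (fun s => a i s v)).
  by rewrite -restrict_EFin -integrable_mkcond.
apply: measurable_bounded_integrable => //.
- apply: (@le_lt_trans _ _ (lebesgue_measure `[0, t])).
    by apply: le_measure; rewrite ?inE//; exact: subIsetl.
  by rewrite lebesgue_measure_itv/=; case: ifP => // _; rewrite -EFinD ltry.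
- exact: subspace_continuous_measurable_fun.
- exists (C * (1 + `|v|)); split; rewrite ?num_real// => M CM s [/= st Ds].
  rewrite (le_trans (CP i s v Ds _)) ?(ltW CM)//.
  by move: st; rewrite in_itv/= => /andP[].
Qed.

(** The velocity is set to 0 outside D, so that the curve exists on all of [0, t]
    even if (s, v) leaves D; linear growth makes the cut off velocity bounded,
    hence integrable. *)
Lemma characteristic_curve (R : realType) (n : nat) (D : set (R * R))
    (a : 'I_n -> R -> R -> R) (t v : R) (p : 'rV[R]_n) :
  rel_open D -> C1_coef D a -> linear_growth D a -> 0 <= t ->
  let g i := (fun s => a i s v) \_ (`[0, t] `&` [set s | D (s, v)]) in
  exists c : R -> 'rV[R]_n, [/\ c 0 = p,
    c t = p + \row_i (\int[lebesgue_measure]_(q in `[0, t]) g i q),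
    {within `[0, t], continuous c} &
    forall s, 0 < s < t -> D (s, v) ->
      forall i, is_derive s 1 (fun r => c r 0 i) (a i s v)].
Proof.
move=> oD Ca growth t0 g.
pose c s := p + \row_i (\int[lebesgue_measure]_(q in `[0, s]) g i q).
exists c.
have intg i : (@lebesgue_measure R).-integrable setT (EFin \o g i).
  exact: characteristic_speed_integrable.
split.
- by rewrite /c; apply/rowP => i; rewrite !mxE set_itv1 Rintegral_set1 addr0.
- by [].
- apply/subspace_continuousP => s st; apply: cvg_rV => i.
  rewrite /c; under eq_cvg do rewrite !mxE; rewrite !mxE.
  apply: cvgD; first exact: cvg_cst.
  have intgt : (@lebesgue_measure R).-integrable `[0, t] (EFin \o g i).
    exact: integrableS (intg i).
  have /subspace_continuousP := parameterized_integral_continuous t0 intgt.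
  by apply.
- move=> s /andP[s0 st] Ds i.
  have gcont : {for s, continuous (g i)}.
    have nS : \forall q \near s, 0 < q < t /\ D (q, v).
      have [U oU DU] := oD.
      have Us : \forall q \near s, U (q, v).
        have scv : (q, v) @[q --> s] --> (s, v).
          exact: (cvg_pair (G := nbhs s) (H := nbhs v) cvg_id (cvg_cst _)).
        by apply: (scv U); apply: open_nbhs_nbhs; split => //; move: Ds; rewrite DU => -[].
      have s0t : \forall q \near s, q \in `]0, t[.
        by apply: near_in_itvoo; rewrite in_itv/= s0.
      apply: filterS2 Us s0t => q Uq; rewrite in_itv/= => qt; split => //.
      by rewrite DU; split => //=; case/andP: qt => /ltW.
    have eqg q : 0 < q < t -> D (q, v) -> g i q = a i q v.
      move=> /andP[q0 qt] Dq; rewrite /g patchE mem_set//; split => //=.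
      by rewrite in_itv/= !ltW.
    have gs : g i s = a i s v by apply: eqg; rewrite ?s0.
    rewrite /prop_for /continuous_at gs.
    have [ca _ _ _ _] := Ca i.
    have : a i q v @[q --> s] --> a i s v.
      apply: (@within_continuous_cvg_comp _ _ _ _ (fun p => a i p.1 p.2) _ _
        (fun q => (q, v)) (s, v) ca Ds).
        exact: (cvg_pair (G := nbhs s) (H := nbhs v) cvg_id (cvg_cst _)).
      by apply: filterS nS => q [].
    apply: cvg_trans; apply: near_eq_cvg; apply: filterS nS => q [qt Dq].
    by rewrite eqg.
  have intgt : (@lebesgue_measure R).-integrable `[0, t] (EFin \o g i).
    exact: integrableS (intg i).
  have [dG eG] := continuous_FTC1_closed st intgt s0 gcont.
  have -> : (fun r => c r 0 i) =
      (fun r => p 0 i + \int[lebesgue_measure]_(q in `[0, r]) g i q).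
    by apply/funext => r; rewrite !mxE.
  rewrite -[a i s v]add0r; apply: is_deriveD.
  apply: DeriveDef => //.
  rewrite -derive1E eG /g patchE mem_set//; split => //=.
  by rewrite in_itv/= !ltW.
Qed.

(** The characteristic with value v = u0 y, followed forwards from time 0. *)
Lemma solution_on_characteristics (R : realType) (n : nat)
    (D : set (R * R)) (a : 'I_n -> R -> R -> R) (u0 : 'rV[R]_n -> R)
    (T : \bar R) (u : R -> 'rV[R]_n -> R) (t : R) (y : 'rV[R]_n) :
  rel_open D -> C1_coef D a -> linear_growth D a -> is_solution D a u0 T u ->
  0 <= t -> (t%:E < T)%E -> (forall s, 0 <= s <= t -> D (s, u0 y)) ->
  u t (y + \row_i displacement a u0 t y i) = u0 y.
Proof.
move=> oD Ca growth sol t0 tT Dy.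
have [c [c0 ct cc dc]] := @characteristic_curve R n D a t (u0 y) y oD Ca growth t0.
have -> : y + \row_i displacement a u0 t y i = c t.
  rewrite ct; congr (_ + _); apply/rowP => i; rewrite !mxE.
  apply: eq_Rintegral => s st; rewrite patchE mem_set//; split => /=; first by rewrite inE in st.
  by apply: Dy; move: st; rewrite inE/= in_itv.
apply: (solution_constant_along_characteristic oD Ca sol tT cc dc (s0 := 0)).
- by rewrite lexx.
- by rewrite c0; have [_ ->] := sol.
- by rewrite t0 lexx.
Qed.

(** The characteristic with value v = u t x, followed backwards from (t, x): it
    keeps this value down to time 0, and its position there is a preimage
    of x. *)
Lemma characteristics_surjective (R : realType) (n : nat)
    (D : set (R * R)) (a : 'I_n -> R -> R -> R) (u0 : 'rV[R]_n -> R)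
    (T : \bar R) (u : R -> 'rV[R]_n -> R) (t : R) (x : 'rV[R]_n) :
  rel_open D -> C1_coef D a -> linear_growth D a -> is_solution D a u0 T u ->
  0 <= t -> (t%:E < T)%E ->
  exists y, y + \row_i displacement a u0 t y i = x.
Proof.
move=> oD Ca growth sol t0 tT.
pose v := u t x.
pose q : 'rV[R]_n := \row_i (\int[lebesgue_measure]_(s in `[0, t])
  ((fun s => a i s v) \_ (`[0, t] `&` [set s | D (s, v)])) s).
have [c [c0 ct cc dc]] := @characteristic_curve R n D a t v (x - q) oD Ca growth t0.
rewrite -/q subrK in ct.
have cst s : 0 <= s <= t -> u s (c s) = v.
  apply: (solution_constant_along_characteristic oD Ca sol tT cc dc (s0 := t)).
    by rewrite t0 lexx.
  by rewrite ct.
have Dv s : 0 <= s <= t -> D (s, v).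
  move=> st; rewrite -(cst s st); have [_ _ h] := sol.
  case/andP: st => s0 st.
  by apply: (h s (c s) s0 _).1; rewrite (le_lt_trans _ tT)// lee_fin.
have u0c : u0 (c 0) = v.
  by have [_ <- _] := sol; apply: cst; rewrite lexx.
exists (c 0); rewrite [in LHS]c0 -[RHS](subrK q); congr (_ + _).
apply/rowP => i; rewrite !mxE /displacement -c0 u0c.
apply: eq_Rintegral => s st; rewrite patchE mem_set//; split => /=; first by rewrite inE in st.
by apply: Dv; move: st; rewrite inE/= in_itv.
Qed.


(** * Continuity of the flow and measurability on tuples *)

(** The set {(s, u0 y) : 0 <= s <= t} being a compact part of D, the integrand
    varies uniformly little in s when y moves a little. *)
Lemma displacement_continuous (R : realType) (n : nat) (D : set (R * R))
    (a : 'I_n -> R -> R -> R) (u0 : 'rV[R]_n -> R) (t : R) (i : 'I_n) :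
  C1_coef D a -> continuous u0 -> 0 <= t ->
  (forall s y, 0 <= s <= t -> D (s, u0 y)) ->
  continuous (fun y => displacement a u0 t y i).
Proof.
move=> Ca cu0 t0 Du0 y.
have [ca _ _ _ _] := Ca i.
have inD s z : s \in `[0, t] -> D (s, u0 z) by rewrite in_itv/=; exact: Du0.
have inta z : (@lebesgue_measure R).-integrable `[0, t] (EFin \o (fun s => a i s (u0 z))).
  apply: continuous_compact_integrable; first exact: segment_compact.
  apply/subspace_continuousP => s st.
  apply: (@within_continuous_cvg_comp _ _ _ _ (fun p => a i p.1 p.2) _ _
    (fun s => (s, u0 z)) (s, u0 z) ca (inD _ _ st)).
    by apply: (cvg_pair (G := nbhs s) (H := nbhs (u0 z))); [exact: cvg_within|exact: cvg_cst].
  by rewrite near_withinE; apply: nearW => q qt; exact: inD.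
suff : displacement a u0 t z i @[z --> y] --> displacement a u0 t y i by [].
apply: (iffRL (@cvgrPdist_le _ _ _ (nbhs y) (nbhs_filter y) _ _)) => e e0.
pose d := e / (t + 1).
have d0 : 0 < d by rewrite divr_gt0// ltr_wpDl.
have unif : \forall z \near y, `[0, t]%classic `<=`
    (fun s => `|a i s (u0 y) - a i s (u0 z)| <= d).
  have /compact_near_coveringP/near_covering_withinP cov := @segment_compact R 0 t.
  apply: (cov _ (nbhs y) (fun z s => `|a i s (u0 y) - a i s (u0 z)| <= d)
    (nbhs_filter y)) => s st.
  have /cvgrPdist_le/(_ (d / 2)) := within_continuous_cvg ca (inD s y st).
  rewrite divr_gt0// => /(_ isT); rewrite near_withinE => /nbhs_ballP[r /= r0 rP].
  near=> q z => qt.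
  have bq : ball s r q by near: q; exact: nbhsx_ballx.
  rewrite -(subrK (a i s (u0 y)) (a i q (u0 y))) -addrA.
  rewrite (le_trans (ler_normD _ _))// [d]splitr lerD//.
    rewrite distrC; apply: (rP (q, u0 y)); last exact: inD.
    by split => //=; exact: ballxx.
  apply: (rP (q, u0 z)); last exact: inD.
  split => //=; near: z.
  by apply: (cu0 y); exact: nbhsx_ballx.
near=> z; have zd : forall s, `[0, t]%classic s -> `|a i s (u0 y) - a i s (u0 z)| <= d.
  by near: z.
rewrite /displacement -RintegralB//.
apply: (le_trans (le_normr_Rintegral _ _)) => //.
  exact: (integrableB _ (inta y) (inta z)).
apply: (@le_trans _ _ (\int[lebesgue_measure]_(s in `[0, t]) d)).
  apply: le_Rintegral => //.
  - exact: (integrable_norm (integrableB _ (inta y) (inta z))).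
  - apply: measurable_bounded_integrable => //.
      rewrite /= lebesgue_measure_itv/=; case: ifP => // _; rewrite -EFinD ltry//.
    by exists d; split; rewrite ?num_real// => M dM s _; rewrite ger0_norm ltW.
rewrite Rintegral_cst//= lebesgue_measure_itv/= lte_fin.
have -> : fine (if 0 < t then (t%:E - 0%:E)%E else 0%E) = t.
  by case: ltgtP t0 => //= _ _; rewrite subr0.
by rewrite -mulrA ler_piMr ?ltW// mulrC ltr_pdivrMr ?mul1r ?ltrDl ?ltr_wpDl.
Unshelve. all: by end_near. Qed.

Lemma measurable_tuple_box (R : realType) (n : nat)
    (A : 'I_n -> set (measurableTypeR R)) : (forall i, measurable (A i)) ->
  measurable [set y : n.-tuple (measurableTypeR R) | forall i, A i (tnth y i)].
Proof.
move=> mA.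
rewrite (_ : [set _ | _] = \bigcap_(i in [set: 'I_n]) ((@tnth n _)^~ i @^-1` A i)).
  apply: fin_bigcap_measurable => // i _.
  by rewrite -[X in measurable X]setTI; apply: (measurable_tnth i).
by apply/seteqP; split => y /= h i; [move=> _; exact: h|exact: h].
Qed.

(** The product sigma-algebra on tuples contains the open sets of the row vectors:
    an open set is the union of the countably many rational cubes that it
    contains. *)
Lemma measurable_tuple_open (R : realType) (n : nat) (U : set 'rV[R]_n) :
  open U ->
  measurable [set y : n.-tuple (measurableTypeR R) | U (\row_i tnth y i)].
Proof.
move=> oU.
pose B (p : {ffun 'I_n -> rat} * nat) : set (n.-tuple (measurableTypeR R)) :=
  [set y | forall i, ball (ratr (p.1 i) : R) p.2.+1%:R^-1 (tnth y i)].
pose good := [set p : {ffun 'I_n -> rat} * nat | forall z : 'rV[R]_n,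
  (forall i, ball (ratr (p.1 i) : R) p.2.+1%:R^-1 (z 0 i)) -> U z].
have -> : [set y : n.-tuple (measurableTypeR R) | U (\row_i tnth y i)] =
    \bigcup_(p in good) B p.
  apply/seteqP; split=> y /=; last first.
    by move=> [p gp Bp]; apply: gp => i; rewrite mxE; exact: Bp.
  move=> Uy; have : nbhs (\row_i tnth y i) U by exact: open_nbhs_nbhs.
  move=> /nbhs_ballP[e /= e0 eU].
  have [k ke] : exists k : nat, k.+1%:R^-1 < e / 2.
    have := near_infty_natSinv_lt (PosNum (divr_gt0 e0 (ltr0Sn R 1))).
    by move=> [k _ /(_ k (leqnn k))]; exists k.
  have k0 : 0 < k.+1%:R^-1 :> R by rewrite invr_gt0.
  (* a rational center within 1/(k+1) of y; the cube has radius 1/(k+1), so its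
     points are within 2/(k+1) < e of y *)
  have qP i : exists q : rat, ball (ratr q : R) k.+1%:R^-1 (tnth y i).
    have [|q] := @rat_in_itvoo R (tnth y i - k.+1%:R^-1) (tnth y i + k.+1%:R^-1).
      by rewrite ltrBlDr -addrA ltrDl addr_gt0.
    by rewrite in_itv/= => qy; exists q; rewrite /ball/= distrC ltr_distlC.
  have [q {}qP] := choice qP.
  exists ([ffun i => q i], k); last by move=> i /=; rewrite ffunE; exact: qP.
  move=> z /= zq; apply: eU; split => // i j; rewrite (ord1 i) mxE.
  have := zq j; rewrite ffunE /ball/= => zqj.
  rewrite -(subrK (ratr (q j)) (tnth y j)) -addrA (le_lt_trans (ler_normD _ _))//.
  rewrite [e]splitr ltrD// ?(lt_trans zqj)//.
  by rewrite distrC (lt_trans (qP j)).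
rewrite bigcup_mkcond; apply: countable_bigcupT_measurable; first exact: countableP.
move=> p; case: ifP => // _.
by apply: (measurable_tuple_box (A := fun i => ball (ratr (p.1 i) : R) p.2.+1%:R^-1))
  => i; exact: measurable_ball.
Qed.

Lemma measurable_tuple_continuous (R : realType) (n : nat) (f : 'rV[R]_n -> R) :
  continuous f ->
  measurable_fun [set: n.-tuple (measurableTypeR R)] (fun y => f (\row_i tnth y i)).
Proof.
move=> cf; apply: (measurability _ (RGenOpens.measurableE R)).
move=> _ [_ [p [q ->]] <-]; rewrite setTI.
apply: (@measurable_tuple_open R n (f @^-1` `]p, q[)).
by apply: open_comp => // x _; exact: cf.
Qed.

Lemma lebesgue_tuple_ball_gt0 (R : realType) (n : nat) (y : 'rV[R]_n) (r : R) :
  0 < r ->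
  (0 < lebesgue_tuple R n [set z | forall i, ball (y 0%R i) r (tnth z i)])%E.
Proof.
move=> r0; rewrite (lebesgue_box (A := fun i => ball (y 0 i) r)); last first.
  by move=> i; exact: measurable_ball.
rewrite (eq_bigr (fun=> (r *+ 2)%:E)); last first.
  by move=> i _; rewrite lebesgue_measure_ball// ltW.
by rewrite prodEFin lte_fin prodr_gt0// => i _; rewrite mulrn_wgt0.
Qed.


(** * Concentration of exponential weights *)

Lemma Rintegral_gt0 d (T : measurableType d) (R : realType)
    (mu : {measure set T -> \bar R}) (D : set T) (f : T -> R) :
  measurable D -> mu.-integrable D (EFin \o f) -> (forall y, D y -> 0 < f y) ->
  (0 < mu D)%E -> 0 < \int[mu]_(y in D) f y.
Proof.
move=> mD intf f0 muD.
have f_ge0 y : D y -> 0 <= f y by move=> /f0/ltW.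
rewrite lt_neqAle Rintegral_ge0// andbT eq_sym; apply/eqP => int0.
have : (\int[mu]_(y in D) `|(f y)%:E| = 0)%E.
  rewrite (eq_integral (EFin \o f)); last first.
    by move=> y; rewrite inE => Dy; rewrite gee0_abs// lee_fin f_ge0.
  by rewrite -[LHS]fineK ?integrable_fin_num//; congr _%:E.
move/(ae_eq_integral_abs _ mD (measurable_int mu intf)).1 => [N [mN N0 DN]].
have : (mu D <= mu N)%E.
  rewrite le_measure ?inE// => y Dy; apply: DN => /= /(_ Dy)/eqP.
  by rewrite eqe gt_eqF// f0.
by rewrite N0 leNgt muD.
Qed.

(** Laplace's principle.  For c >= 1 the part of the numerator where r >= d is at
    most exp (- (c - 1) d) times a constant, while the denominator is at least
    exp (- (c - 1) d / 2) times the mass of the weight at c = 1 over r < d / 2,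
    which is positive.  The remaining part, where r < d, is within e of v times the
    denominator. *)
Lemma laplace_concentration d (T : measurableType d) (R : realType)
    (mu : {measure set T -> \bar R}) (g r h : T -> R) (v M : R) :
  measurable_fun setT g -> measurable_fun setT r -> measurable_fun setT h ->
  (forall y, 0 < g y) -> (forall y, 0 <= r y) -> (forall y, `|h y| <= M) ->
  (forall c, 0 < c ->
    mu.-integrable setT (fun y => (g y * expR (- (c * r y)))%:E)) ->
  (forall d, 0 < d -> (0 < mu [set y | (r y < d)%R])%E) ->
  (forall e, 0 < e -> exists2 d, 0 < d & forall y, r y < d -> `|h y - v| <= e) ->
  (\int[mu]_y (h y * (g y * expR (- (c * r y))))) /
    (\int[mu]_y (g y * expR (- (c * r y)))) @[c --> +oo] --> v.
Proof.
move=> mg mr mh g0 r0 hM intw mu0 hv.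
pose w c y := g y * expR (- (c * r y)).
have w0 c y : 0 < w c y by rewrite mulr_gt0// expR_gt0.
(* every weight is compared with the one at c = 1 *)
have w1 c y : w c y = expR (- ((c - 1) * r y)) * w 1 y.
  rewrite /w mulrCA -expRD; congr (_ * expR _).
  by rewrite -opprD -mulrDl subrK.
have iw c : 0 < c -> mu.-integrable setT (EFin \o w c) by exact: intw.
have ihw c : 0 < c -> mu.-integrable setT (EFin \o (fun y => h y * w c y)).
  move=> c0; apply: (integrableMr measurableT mh _ (iw c c0)).
  by exists M; split; rewrite ?num_real// => x Mx y _ /=; rewrite (le_trans (hM y))// ltW.
apply/cvgrPdist_le => e e0.
have [dl dl0 dlP] := hv _ (divr_gt0 e0 (ltr0Sn R 1)).
pose D := [set y | r y < dl / 2].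
have mD : measurable D.
  by rewrite -[D]setTI /D -preimage_itvNyo; apply: mr => //; exact: measurable_itv.
have iwD c : 0 < c -> mu.-integrable D (EFin \o w c).
  by move=> c0; exact: integrableS (iw c c0).
pose k := \int[mu]_(y in D) w 1 y.
have k0 : 0 < k by apply: Rintegral_gt0; [| exact: iwD | | apply: mu0; rewrite divr_gt0].
pose Z1 := \int[mu]_y w 1 y.
have Z10 : 0 <= Z1 by apply: Rintegral_ge0 => y _; exact: ltW.
(* |M + |v|| bounds |h - v|; K * exp (- (c - 1) dl / 2) bounds the relative
   contribution of the region where r >= dl *)
pose K := `|M + `|v| | * Z1 / k.
have K0 : 0 <= K by rewrite divr_ge0 ?mulr_ge0// ltW.
near=> c.
have c1 : 1 <= c by near: c; exact: nbhs_pinfty_ge.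
have c0 : 0 < c by exact: lt_le_trans c1.
have c10 : 0 <= c - 1 by rewrite subr_ge0.
have cK : K * expR (- ((c - 1) * (dl / 2))) <= e / 2.
  rewrite expRN ler_pdivrMr ?expR_gt0//.
  have : 1 + (c - 1) * (dl / 2) <= expR ((c - 1) * (dl / 2)) := expR_ge1Dx _.
  move=> /(ler_wpM2l (ltW (divr_gt0 e0 (ltr0Sn R 1)))); apply: le_trans.
  rewrite -ler_pdivrMl ?divr_gt0// -lerBlDl -ler_pdivrMr ?divr_gt0// lerBrDl.
  by near: c; apply: nbhs_pinfty_ge; exact: num_real.
pose Z := \int[mu]_y w c y.
have Zk : expR (- ((c - 1) * (dl / 2))) * k <= Z.
  rewrite -RintegralZl//; last exact: iwD.
  rewrite /Z (Rintegral_mkcond mu D); apply: le_Rintegral => //.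
  - rewrite -restrict_EFin -integrable_mkcond//.
    exact: (integrableZl mD _ (iwD 1 ltr01)).
  - exact: iw.
  move=> y _; rewrite patchE; case: ifPn => [|_]; last exact: ltW.
  rewrite inE /D/= => yd; rewrite (w1 c) ler_wpM2r ?(ltW (w0 _ _))// ler_expR lerN2.
  by rewrite ler_wpM2l ?(ltW yd).
have Z0 : 0 < Z by rewrite (lt_le_trans _ Zk)// mulr_gt0// expR_gt0.
have -> : v - (\int[mu]_y (h y * w c y)) / Z =
    - (\int[mu]_y (h y * w c y - v * w c y)) / Z.
  rewrite RintegralB//; [|exact: ihw|exact: (integrableZl measurableT _ (iw c c0))].
  rewrite RintegralZl//; last exact: iw.
  by rewrite opprB mulrBl mulfK ?gt_eqF.
rewrite normrM normrN normfV (gtr0_norm Z0) ler_pdivrMr//.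
have idev : mu.-integrable setT (EFin \o (fun y => h y * w c y - v * w c y)).
  exact: (integrableB _ (ihw c c0) (integrableZl measurableT _ (iw c c0))).
apply: le_trans (le_normr_Rintegral _ idev) _ => //.
pose A := `|M + `|v| | * expR (- ((c - 1) * dl)).
apply: (@le_trans _ _ (\int[mu]_y (e / 2 * w c y + A * w 1 y))).
  apply: le_Rintegral => //.
  - exact: (integrable_norm idev).
  - exact: (integrableD _ (integrableZl measurableT _ (iw c c0))
      (integrableZl measurableT _ (iw 1 ltr01))).
  move=> y _; rewrite -mulrBl normrM (gtr0_norm (w0 c y)).
  have [yd|dy] := ltP (r y) dl.
    rewrite ler_wpDr ?ler_wpM2r ?dlP// ?(ltW (w0 _ _))//.
    by rewrite mulr_ge0 ?(ltW (w0 _ _))// mulr_ge0// expR_ge0.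
  apply: ler_wpDl; first by apply: mulr_ge0; [rewrite divr_ge0// ltW|exact: ltW].
  rewrite (w1 c) mulrA ler_wpM2r ?(ltW (w0 _ _))// ler_pM ?expR_ge0//.
    rewrite (le_trans (ler_normB _ _))// (le_trans _ (ler_norm _))// lerD2r.
    exact: hM.
  by rewrite ler_expR lerN2 ler_wpM2l.
rewrite RintegralD//; [|exact: (integrableZl measurableT _ (iw c c0))
  |exact: (integrableZl measurableT _ (iw 1 ltr01))].
rewrite !RintegralZl//; [|exact: iw|exact: iw].
rewrite [e in leRHS]splitr mulrDl lerD2l -/Z1.
apply: (@le_trans _ _ (e / 2 * (expR (- ((c - 1) * (dl / 2))) * k))); last first.
  by rewrite ler_wpM2l// divr_ge0 ?ltW.
rewrite /A [X in - ((c - 1) * X)](splitr dl) mulrDr opprD expRD.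
set E := expR _.
have -> : `|M + `|v| | * (E * E) * Z1 = (K * E) * (E * k).
  by rewrite /K; field; rewrite gt_eqF.
by rewrite ler_wpM2r// mulr_ge0 ?expR_ge0// ltW.
Unshelve. all: by end_near. Qed.


(** * Measures tested against functions vanishing at infinity *)

Lemma C0_small_outside (R : realType) (phi : R -> R) :
  continuous phi ->
  (forall e, 0 < e -> exists A, forall v, A <= `|v| -> `|phi v| <= e) -> C0 phi.
Proof.
move=> cphi small; split => //; apply/cvgrPdist_le => e e0;
  have [A AP] := small e e0; near=> v; rewrite sub0r normrN; apply: AP.
- by rewrite (le_trans _ (ler_norm v))//; near: v; apply: nbhs_pinfty_ge; exact: num_real.
- rewrite -normrN (le_trans _ (ler_norm _))// lerNr.
  by near: v; apply: nbhs_ninfty_le; exact: num_real.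
Unshelve. all: by end_near. Qed.

(** Unlike [Num.max 0 x], this form of the positive part is continuous by the
    rules for sums, products and norms. *)
Definition pospart (R : realType) (x : R) : R := (x + `|x|) / 2.

Lemma pospart_le0 (R : realType) (x : R) : x <= 0 -> pospart x = 0.
Proof. by move=> x0; rewrite /pospart ler0_norm// subrr mul0r. Qed.

Lemma pospart_ge0 (R : realType) (x : R) : 0 <= x -> pospart x = x.
Proof. by move=> x0; rewrite /pospart ger0_norm// -mulr2n -[_ *+ _]mulr_natr mulfK. Qed.

Lemma pospart_continuous (R : realType) (f : R -> R) :
  continuous f -> continuous (fun v => pospart (f v)).
Proof.
move=> cf v; apply: cvgM; last exact: cvg_cst.
by apply: cvgD; [exact: cf|apply: cvg_norm; exact: cf].
Qed.

(** One test function suffices: psi is continuous, vanishes at infinity, is 0 on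
    [-M, M] and positive elsewhere, so that its integral being 0 makes the
    complement of [-M, M] negligible. *)
Lemma measure_supported_ball (R : realType)
    (Q : {measure set (measurableTypeR R) -> \bar R}) (M : R) :
  (forall phi, C0 phi -> (forall v, `|v| <= M -> phi v = 0) ->
    (\int[Q]_v (phi v)%:E = 0)%E) ->
  {ae Q, forall v, `|v| <= M}.
Proof.
move=> Q0.
pose psi (v : R) := pospart (expR (- M) - expR (- `|v|)) * expR (- `|v|).
have cexp : continuous (fun v : R => expR (- `|v|)).
  move=> v; apply: (@continuous_cvg _ _ _ _ _ (fun v : R => - `|v|) expR).
    exact: continuous_expR.
  by apply: cvgN; exact: norm_continuous.
have cpsi : continuous psi.
  move=> v; apply: cvgM; last exact: cexp.
  apply: (@pospart_continuous R (fun v => expR (- M) - expR (- `|v|))) => {}v.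
  by apply: cvgB; [exact: cvg_cst|exact: cexp].
have pp0 x : 0 <= pospart x :> R.
  by have [/pospart_le0->//|/ltW x0] := leP x 0; rewrite pospart_ge0.
have psi_ge0 v : 0 <= psi v by rewrite mulr_ge0// expR_ge0.
have C0psi : C0 psi.
  apply: C0_small_outside => // e e0; exists (expR (- M) / e) => v ve.
  have ppM : pospart (expR (- M) - expR (- `|v|)) <= expR (- M).
    have [/pospart_le0->|/ltW x0] := leP (expR (- M) - expR (- `|v|)) 0.
      exact: expR_ge0.
    by rewrite pospart_ge0// gerBl expR_ge0.
  rewrite ger0_norm// (le_trans (ler_wpM2r (expR_ge0 _) ppM))//.
  rewrite (expRN `|v|) ler_pdivrMr ?expR_gt0// -ler_pdivrMl// mulrC.
  by rewrite (le_trans ve)// (le_trans _ (expR_ge1Dx _))// lerDr.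
have mpsi : measurable_fun [set: measurableTypeR R] (EFin \o psi).
  by apply/measurable_EFinP; exact: continuous_measurable_fun.
have psi0 v : `|v| <= M -> psi v = 0.
  by move=> vM; rewrite /psi pospart_le0 ?mul0r// subr_le0 ler_expR lerN2.
have int0 : (\int[Q]_v `|(EFin \o psi) v| = 0)%E.
  rewrite -[RHS](Q0 psi C0psi psi0); apply: eq_integral => v _.
  by rewrite gee0_abs// lee_fin.
have := (ae_eq_integral_abs Q measurableT mpsi).1 int0.
apply: filterS => v /(_ I)/= [psiv]; rewrite leNgt; apply/negP => Mv.
move: psiv; apply/eqP; rewrite gt_eqF// mulr_gt0 ?expR_gt0//.
have x0 : 0 < expR (- M) - expR (- `|v|) by rewrite subr_gt0 ltr_expR ltrN2.
by rewrite pospart_ge0// ltW.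
Qed.

(** Multiply f by a cutoff equal to 1 on [-M, M] and to 0 beyond M + 1. *)
Lemma exists_C0_extension (R : realType) (f : R -> R) (M : R) :
  continuous f -> exists2 phi, C0 phi & forall v, `|v| <= M -> phi v = f v.
Proof.
move=> cf; exists (fun v => f v * pospart (1 - pospart (`|v| - M))); last first.
  by move=> v vM; rewrite (@pospart_le0 _ (`|v| - M)) ?subr_le0// subr0 pospart_ge0// mulr1.
apply: C0_small_outside.
  move=> v; apply: cvgM; first exact: cf.
  apply: (@pospart_continuous R (fun v => 1 - pospart (`|v| - M))) => {}v.
  apply: cvgB; first exact: cvg_cst.
  apply: (@pospart_continuous R (fun v => `|v| - M)) => {}v; apply: cvgB; last exact: cvg_cst.
  exact: norm_continuous.
move=> e e0; exists (M + 1) => v Mv.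
have v1 : 1 <= `|v| - M by rewrite lerBrDl.
rewrite (@pospart_ge0 _ (`|v| - M)) ?(le_trans ler01)//.
by rewrite pospart_le0 ?subr_le0// mulr0 normr0 ltW.
Qed.

Lemma Rintegral_supported_ball (R : realType)
    (Q : {measure set (measurableTypeR R) -> \bar R}) (M : R) (f phi : R -> R) :
  {ae Q, forall v, `|v| <= M} -> continuous f -> continuous phi ->
  (forall v, `|v| <= M -> phi v = f v) -> \int[Q]_v f v = \int[Q]_v phi v.
Proof.
move=> QM cf cphi fphi; congr fine; apply: ae_eq_integral => //.
- by apply/measurable_EFinP; exact: continuous_measurable_fun.
- by apply/measurable_EFinP; exact: continuous_measurable_fun.
- have FQ : Filter (almost_everywhere Q) by exact: ae_filter_ringOfSetsType.
  by apply: (@filterS _ _ FQ _ _ _ QM) => v vM _ /=; rewrite fphi.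
Qed.

(** A functional that only sees the values of its argument on [-M, M] can only be
    represented by a measure living there, and on that interval every continuous
    function agrees with one that vanishes at infinity. *)
Lemma Rintegral_of_C0_functional (R : realType)
    (Q : {measure set (measurableTypeR R) -> \bar R}) (L : (R -> R) -> R)
    (M : R) (f : R -> R) :
  (forall phi, C0 phi -> (\int[Q]_v (phi v)%:E)%E = (L phi)%:E) ->
  (forall phi psi, (forall v, `|v| <= M -> phi v = psi v) -> L phi = L psi) ->
  L (fun=> 0) = 0 -> continuous f -> \int[Q]_v f v = L f.
Proof.
move=> QL Lext L0 cf.
have QM : {ae Q, forall v, `|v| <= M}.
  apply: measure_supported_ball => phi C0phi phi0.
  by rewrite QL// (Lext phi (fun=> 0))// L0.
have [phi C0phi phif] := exists_C0_extension M cf.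
have [cphi _ _] := C0phi.
rewrite (Rintegral_supported_ball QM cf cphi phif) -(Lext _ _ phif).
by rewrite /Rintegral QL.
Qed.

(** A divergent integral has real value 0 by convention, so a nonzero value is
    evidence of convergence. *)
Lemma Rintegral_neq0_integrable d (T : measurableType d) (R : realType)
    (mu : {measure set T -> \bar R}) (f : T -> R) :
  measurable_fun setT f -> (forall y, 0 <= f y) -> \int[mu]_y f y != 0 ->
  mu.-integrable setT (EFin \o f).
Proof.
move=> mf f0 intf; apply/integrableP; split; first exact/measurable_EFinP.
rewrite (eq_integral (EFin \o f)); last by move=> y _; rewrite gee0_abs// lee_fin.
rewrite ltey; apply: contra intf => /eqP intf.
by rewrite /Rintegral intf.
Qed.


(** * The average over characteristics that end near a point *)

Lemma continuous_sum_dist_sqr (R : realType) (T : topologicalType) (n : nat)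
    (f g : 'I_n -> T -> R) (k : 'I_n -> R) :
  (forall i, continuous (f i)) -> (forall i, continuous (g i)) ->
  continuous (fun y => \sum_(i < n) `|f i y + g i y - k i| ^+ 2).
Proof.
move=> cf cg; apply: continuous_big => [|i _ y]; first exact: (@add_continuous R).
apply: (@continuous_cvg _ _ _ _ _ (fun y => `|f i y + g i y - k i|)
  (fun z => z ^+ 2)); first exact: exprn_continuous.
apply: cvg_norm; apply: cvgB; last exact: cvg_cst.
by apply: cvgD; [exact: cf|exact: cg].
Qed.

(** The square of the distance by which the characteristic issued from y misses x
    at time t. *)
Definition sq_miss (R : realType) (n : nat) (a : 'I_n -> R -> R -> R)
    (u0 : 'rV[R]_n -> R) (t : R) (x y : 'rV[R]_n) : R :=
  \sum_(i < n) `|displacement a u0 t y i + y 0 i - x 0 i| ^+ 2.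

Section Concentration.
Variables (R : realType) (n : nat) (D : set (R * R)) (a : 'I_n -> R -> R -> R).
Variables (u0 rho0 : 'rV[R]_n -> R) (T : \bar R) (u : R -> 'rV[R]_n -> R).
Hypotheses (openD : rel_open D) (C1a : C1_coef D a) (growth : linear_growth D a).
Hypothesis cu0 : continuous u0.
Hypothesis solution : is_solution D a u0 T u.
Variables (t : R) (x : 'rV[R]_n).
Hypotheses (t0 : 0 <= t) (tT : (t%:E < T)%E).
Hypothesis Du0 : forall s y, 0 <= s <= t -> D (s, u0 y).

Local Notation miss := (sq_miss a u0 t x).

Lemma miss_continuous : continuous miss.
Proof.
apply: (@continuous_sum_dist_sqr R 'rV[R]_n n
  (fun i y => displacement a u0 t y i) (fun i y => y 0 i) (fun i => x 0 i)) => i.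
  exact: displacement_continuous C1a cu0 t0 Du0.
exact: coord_continuous.
Qed.

(** A preimage of x under the flow has miss 0, and the miss stays small on a
    cube around it. *)
Lemma miss_small_measure (d : R) : 0 < d ->
  (0 < lebesgue_tuple R n [set y | (miss (\row_i tnth y i) < d)%R])%E.
Proof.
move=> d0.
have [y0 y0x] := characteristics_surjective x openD C1a growth solution t0 tT.
have miss0 : miss y0 = 0.
  rewrite /sq_miss big1// => i _; move/rowP : y0x => /(_ i); rewrite !mxE => <-.
  by rewrite [X in X - _]addrC subrr normr0 expr0n.
have : \forall y \near y0, miss y < d.
  by have /cvgr_lt := @miss_continuous y0; apply; rewrite miss0.
move=> /nbhs_ballP[e /= e0 eP].
apply: (lt_le_trans (lebesgue_tuple_ball_gt0 y0 e0)).
apply: le_measure; rewrite ?inE.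
- apply: (measurable_tuple_box (A := fun i => ball (y0 0 i) e)) => i.
  exact: measurable_ball.
- apply: (@measurable_tuple_open R n [set y | miss y < d]).
  apply: (@open_comp _ _ miss [set z | z < d]); last exact: open_lt.
  by move=> y _; exact: miss_continuous.
- move=> y /= yB; apply: eP; split => // i j.
  by rewrite (ord1 i) mxE; exact: yB.
Qed.

(** The solution carries u0 y to the point that the characteristic of y reaches,
    and that point is near x when the miss is small. *)
Lemma miss_small_value (e : R) : 0 < e ->
  exists2 d, 0 < d & forall y, miss y < d -> `|u0 y - u t x| <= e.
Proof.
move=> e0.
have [[cu _ _ _ _] _ _] := solution.
have St (z : 'rV[R]_n) : strip T (t, z) by [].
have ut : u t z @[z --> x] --> u t x.
  have xt : (t, z) @[z --> x] --> (t, x).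
    exact: (@cvg_pair _ _ _ (nbhs x) (nbhs t) (nbhs x) (nbhs_filter x)
      (nbhs_filter t) (nbhs_filter x) (fun=> t) id
      (@cvg_cst _ t _ (nbhs x) (nbhs_filter x)) cvg_id).
  have xS := @filterE _ (nbhs x) (nbhs_filter x) _ St.
  exact: (@within_continuous_cvg_comp _ _ _ _ (fun p => u p.1 p.2) (nbhs x)
    (nbhs_filter x) (fun z => (t, z)) (t, x) cu (St x) xt xS).
have : \forall z \near x, `|u t x - u t z| <= e.
  by have /(_ e e0) := iffLR (@cvgrPdist_le _ _ _ (nbhs x) (nbhs_filter x) _ _) ut.
move=> /nbhs_ballP[r /= r0 rP]; exists (r ^+ 2); first by rewrite exprn_gt0.
move=> y yr.
rewrite -(solution_on_characteristics openD C1a growth solution t0 tT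
  (fun s => @Du0 s y)) distrC.
apply: rP; split => // i j; rewrite (ord1 i) !mxE /ball/= distrC.
rewrite -ltr_sqr ?nnegrE ?(ltW r0)// (le_lt_trans _ yr)//.
rewrite /sq_miss (bigD1 j)//= [y 0 j + _]addrC lerDl.
by apply: sumr_ge0 => k _; exact: exprn_ge0.
Qed.

End Concentration.

Lemma laplace_parameter_cvg (R : realType) (t : R) : 0 < t ->
  (2 * sigma ^+ 2 * t)^-1 @[sigma --> 0^'+] --> +oo.
Proof.
move=> t0; apply/gtr0_cvgV0.
  near=> s; have s0 : 0 < s by near: s; exact: nbhs_right_gt.
  by rewrite invr_gt0 !mulr_gt0// exprn_gt0.
under eq_cvg do rewrite /= invrK.
have : 2 * s ^+ 2 * t @[s --> (0 : R)] --> 2 * 0 ^+ 2 * t.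
  apply: cvgM; last exact: cvg_cst.
  by apply: cvgM; [exact: cvg_cst|exact: exprn_continuous].
rewrite expr0n/= mulr0 mul0r; exact: cvg_within_filter.
Unshelve. all: by end_near. Qed.

Section Density.
Variables (R : realType) (n : nat) (a : 'I_n -> R -> R -> R).
Variables (u0 rho0 : 'rV[R]_n -> R) (T : \bar R) (P : density_family R n) (M : R).
Hypotheses (u0M : forall y, `|u0 y| <= M).
Hypotheses (density : is_density a u0 rho0 T P) (defined : usigma_defined T P).

Lemma Rintegral_density0 (sigma : R) x f : 0 < sigma -> continuous f ->
  \int[P sigma 0 x]_v f v = f (u0 x) * rho0 x.
Proof.
move=> s0 cf.
apply: (@Rintegral_of_C0_functional _ _ (fun f => f (u0 x) * rho0 x) M) => //.
- by move=> phi C0phi; have [] := density x s0 C0phi.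
- by move=> phi psi e; rewrite e.
- by rewrite mul0r.
Qed.

Lemma Rintegral_densityS (sigma t : R) x f : 0 < sigma -> 0 < t -> (t%:E < T)%E ->
  continuous f ->
  \int[P sigma t x]_v f v = (Num.sqrt (2 * pi * t) * sigma) ^- n *
    integral_Rn (fun y => f (u0 y) * rho0 y *
      expR (- ((2 * sigma ^+ 2 * t)^-1 * sq_miss a u0 t x y))).
Proof.
move=> s0 t0 tT cf.
apply: (@Rintegral_of_C0_functional _ _ (fun f =>
  (Num.sqrt (2 * pi * t) * sigma) ^- n *
    integral_Rn (fun y => f (u0 y) * rho0 y *
      expR (- ((2 * sigma ^+ 2 * t)^-1 * sq_miss a u0 t x y)))) M) => //.
- move=> phi C0phi; have [_ ->//] := density x s0 C0phi.
  congr (_ * _)%:E; apply: eq_Rintegral => y _.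
  by rewrite mulNr [X in - X]mulrC.
- move=> phi psi e; congr (_ * _); apply: eq_Rintegral => y _.
  by rewrite e.
- rewrite /integral_Rn; under eq_Rintegral do rewrite !mul0r.
  by rewrite Rintegral_cst// mul0r mulr0.
Qed.

(** At time 0 the denominator of [usigma] is rho0 y. *)
Lemma rho0_gt0 : (forall y, 0 <= rho0 y) -> (0 < T)%E -> forall y, 0 < rho0 y.
Proof.
move=> rho_ge0 T0 y; rewrite lt_neqAle rho_ge0 andbT eq_sym.
have [_] := @defined 1 0 y ltr01 (lexx _) T0.
by rewrite Rintegral_density0// ?mul1r// => v; exact: cvg_cst.
Qed.

End Density.

(** * Convergence of the averages *)

Unset Implicit Arguments.
Set Strict Implicit.
Set Printing Implicit Defensive.

Theorem theorem1 (R : realType) (n : nat) (n_gt0 : (0 < n)%N)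
    (D : set (R * R)) (a : 'I_n -> R -> R -> R)
    (u0 rho0 : 'rV[R]_n -> R) (u : R -> 'rV[R]_n -> R)
    (P : density_family R n)
    (openD : rel_open D) (C1a : C1_coef D a) (growth : linear_growth D a)
    (C1u0 : C1b u0)
    (rho0_cont : continuous rho0) (rho0_bounded : bounded_fun rho0)
    (rho0_ge0 : forall x, 0 <= rho0 x)
    (tstar_gt0 : (0 < tstar D a u0)%E)
    (solution : is_solution D a u0 (tstar D a u0) u)
    (density : is_density a u0 rho0 (tstar D a u0) P)
    (defined : usigma_defined (tstar D a u0) P) :
  forall (t : R) (x : 'rV[R]_n), 0 <= t -> (t%:E < tstar D a u0)%E ->
    usigma P sigma t x @[sigma --> 0^'+] --> ubar P t x /\
    u t x = ubar P t x.
Proof.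
move=> t x t0 tT.
suff lim : usigma P sigma t x @[sigma --> 0^'+] --> u t x.
  have ubarE : ubar P t x = u t x by exact: cvg_lim lim.
  by rewrite ubarE.
have [[M0 [_ M0P]] cu0 _ _ _] := C1u0.
pose M := `|M0| + 1.
have u0M y : `|u0 y| <= M.
  by apply: (M0P M) => //; rewrite /M (le_lt_trans (ler_norm _))// ltrDl.
have rho_gt0 := rho0_gt0 u0M density defined rho0_ge0 tstar_gt0.
have cst1 : continuous (fun _ : R => 1 : R) by move=> v; exact: cvg_cst.
have cid : continuous (fun v : R => v) by move=> v; exact: cvg_id.
move: t0; rewrite le_eqVlt => /predU1P[t0|t_gt0].
  (* at time 0 the average is u0 x for every sigma *)
  rewrite -t0 in tT *; have [_ -> _] := solution.
  apply: cvg_near_cst; near=> s.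
  have s0 : 0 < s by near: s; exact: nbhs_right_gt.
  rewrite /usigma !(Rintegral_density0 u0M density)// mul1r mulfK//.
  by rewrite gt_eqF.
have t0 := ltW t_gt0.
have Du0 s y : 0 <= s <= t -> D (s, u0 y).
  move=> /andP[s0 st]; have [_ [t' [_ Dt' _] <-]] := ereal_sup_gt tT.
  by rewrite lte_fin => /ltW tt'; apply: Dt'; rewrite s0 (le_trans st).
pose miss := sq_miss a u0 t x.
pose row_of (y : n.-tuple (measurableTypeR R)) : 'rV[R]_n := \row_i tnth y i.
have cmiss : continuous miss := miss_continuous C1a cu0 t0 Du0.
(* the Gaussian prefactor cancels in the quotient *)
have usigmaE s : 0 < s -> usigma P s t x =
    (\int[lebesgue_tuple R n]_y (u0 (row_of y) * (rho0 (row_of y) *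
      expR (- ((2 * s ^+ 2 * t)^-1 * miss (row_of y)))))) /
    (\int[lebesgue_tuple R n]_y (rho0 (row_of y) *
      expR (- ((2 * s ^+ 2 * t)^-1 * miss (row_of y))))).
  move=> s0; rewrite /usigma !(Rintegral_densityS u0M density)//.
  rewrite -mulf_div mulfV ?mul1r; last first.
    rewrite invr_neq0// expf_neq0// mulf_neq0 ?gt_eqF// sqrtr_gt0.
    by rewrite !mulr_gt0// pi_gt0.
  rewrite /integral_Rn; congr (_ / _); apply: eq_Rintegral => y _.
    by rewrite mulrA.
  by rewrite mul1r.
have integrable_weight c : 0 < c ->
    (lebesgue_tuple R n).-integrable setT (EFin \o (fun y =>
      rho0 (row_of y) * expR (- (c * miss (row_of y))))).
  move=> c0; apply: Rintegral_neq0_integrable.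
  - apply: measurable_funM; first exact: measurable_tuple_continuous.
    apply: measurableT_comp; first exact: measurable_expR.
    apply: measurableT_comp => //; apply: measurable_funM; first exact: measurable_cst.
    exact: measurable_tuple_continuous.
  - by move=> y; rewrite mulr_ge0// expR_ge0.
  (* the noise level whose weight has parameter c *)
  pose s := Num.sqrt (2 * c * t)^-1.
  have s0 : 0 < s by rewrite sqrtr_gt0 invr_gt0 !mulr_gt0.
  have cE : c = (2 * s ^+ 2 * t)^-1.
    rewrite /s sqr_sqrtr ?invr_ge0 ?mulr_ge0 ?(ltW c0)//.
    by field; rewrite !gt_eqF.
  have [_] := @defined s t x s0 t0 tT; apply: contra => /eqP int0.
  rewrite (Rintegral_densityS u0M density)// /integral_Rn.
  under eq_Rintegral do rewrite mul1r -cE.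
  by rewrite int0 mulr0.
have lim : (\int[lebesgue_tuple R n]_y (u0 (row_of y) * (rho0 (row_of y) *
      expR (- (c * miss (row_of y)))))) /
    (\int[lebesgue_tuple R n]_y (rho0 (row_of y) *
      expR (- (c * miss (row_of y))))) @[c --> +oo] --> u t x.
  apply: (@laplace_concentration _ _ _ (lebesgue_tuple R n) (rho0 \o row_of)
    (miss \o row_of) (u0 \o row_of) (u t x) M) => //.
  - exact: measurable_tuple_continuous.
  - exact: measurable_tuple_continuous.
  - exact: measurable_tuple_continuous.
  - by move=> y; exact: rho_gt0.
  - by move=> y; apply: sumr_ge0 => i _; exact: exprn_ge0.
  - by move=> y; exact: u0M.
  - by move=> d; exact: (miss_small_measure openD C1a growth cu0 solution x t0 tT Du0).
  - move=> e e0.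
    have [d d0 dP] := miss_small_value openD C1a growth solution x t0 tT Du0 e0.
    by exists d => // y; exact: dP.
apply: cvg_trans (cvg_comp _ _ (laplace_parameter_cvg t_gt0) lim).
apply: near_eq_cvg; near=> s; rewrite /= usigmaE//.
Unshelve. all: by end_near. Qed.
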